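(* Let $G$ be a connected graph containing neither a bull nor a claw as an induced subgraph. Then at least one of the following holds: (i) $G$ contains $\overline{C}_7\oplus K_1$; (ii) $G$ contains $C_5\oplus K_2$; (iii) $G$ contains $M_4\oplus K_1$ or $M_7\oplus K_1$; (iv) for some $i\geq 1$, $G$ contains a clique expansion $C_{2i+1}[k_1,\ldots,k_{2i+1}]$ of one of the following two forms: $(k_1,\ldots,k_{2i+1})=(2,2,\ldots,2,1,3,1,3,\ldots,3,1)$, i.e. an even number $a\geq 0$ of entries equal to $2$ followed by an alternating sequence $1,3,1,3,\ldots,3,1$ beginning and ending with $1$; or $(k_1,\ldots,k_{2i+1})=(2,2,\ldots,2,1)$; (v) $G$ contains an induced cycle $C_5$ and $|V(G)|>8$; (vi) $G$ is $4$-colorable.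
   Context: A bull is the graph with vertices $v_1,\ldots,v_5$ and edges $v_1v_2,v_2v_3,v_3v_4,v_4v_5,v_2v_4$; a claw is $K_{1,3}$. ''$G$ contains $H$'' means $G$ has a (not necessarily induced) subgraph isomorphic to $H$. $\overline{C}_7$ is the complement of the $7$-cycle. For graphs $G,H$, $G\oplus H$ is the join: vertex set $V(G)\cup V(H)$ (disjoint), edges $E(G)\cup E(H)\cup\{vw: v\in V(G), w\in V(H)\}$. For $p\geq1$, the spindle graph $M_{3p+1}$ is a graph of order $3p+1$ containing a cycle $u_0u_1\ldots u_{3p}u_0$ such that, for each $i\in\{1,\ldots,p\}$ (indices modulo $3p+1$), $N(u_{3i})=\{u_{3i-2},u_{3i-1},u_{3i+1},u_{3i+2}\}$ and $N(u_{3i-1})\cap N(u_{3i-2})=\{u_{3i-3},u_{3i}\}$. Thus $M_4\cong K_4$ and $M_7$ is the Moser spindle. For $p\geq3$ and positive integers $k_1,\ldots,k_p$, the clique expansion $C_p[k_1,\ldots,k_p]$ replaces vertex $v_i$ of the cycle $v_1\ldots v_p$ by a clique of size $k_i$, with complete adjacency between cliques of cyclically consecutive vertices and no edges between other distinct cliques.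
   Formalization: The stated neighbourhood of u_{3p} would put an extra edge u_{3p}u_1 in M_{3p+1} for p≥2, contradicting ''M_7 is the Moser spindle'' and making the claim false for the Moser spindle joined with K_1; M_7 is taken to be the Moser spindle (11 edges). *)

(* Defs.v *)
From HB Require Import structures.
From mathcomp Require Import all_boot.

Set Implicit Arguments.
Unset Strict Implicit.
Unset Printing Implicit Defensive.

Record sgraph := SGraph {
  vertex :> finType;
  adj : rel vertex;
  adj_sym : symmetric adj;
  adj_irrefl : irreflexive adj }.

Section SymGraph.
Variables (T : finType) (r : rel T).

Definition sym_adj : rel T := fun x y => (x != y) && (r x y || r y x).

Lemma sym_adj_sym : symmetric sym_adj.
Proof. by move=> x y; rewrite /sym_adj eq_sym orbC. Qed.

Lemma sym_adj_irrefl : irreflexive sym_adj.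
Proof. by move=> x; rewrite /sym_adj eqxx. Qed.

Definition sym_graph : sgraph := SGraph sym_adj_sym sym_adj_irrefl.
End SymGraph.

Definition connected (G : sgraph) : Prop :=
  forall x y : G, connect (@adj G) x y.

(* Containment as a subgraph, not necessarily induced. *)
Definition contains (G H : sgraph) : Prop :=
  exists2 f : H -> G, injective f & forall x y, adj x y -> adj (f x) (f y).

Definition contains_induced (G H : sgraph) : Prop :=
  exists2 f : H -> G, injective f & forall x y, adj (f x) (f y) = adj x y.

Definition colorable (G : sgraph) (k : nat) : Prop :=
  exists c : G -> 'I_k, forall x y, adj x y -> c x != c y.

Definition complete (n : nat) : sgraph :=
  sym_graph (fun _ _ : 'I_n => true).

(* The cycle C_n, for n >= 3. *)
Definition cycle_graph (n : nat) : sgraph :=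
  sym_graph (fun i j : 'I_n => j == ordS i).

Definition complete_bipartite (m n : nat) : sgraph :=
  sym_graph (fun x y : 'I_m + 'I_n => is_inl x && ~~ is_inl y).

Definition claw : sgraph := complete_bipartite 1 3.

(* The vertex v_i is the ordinal i - 1. *)
Definition bull : sgraph :=
  sym_graph (fun i j : 'I_5 =>
    ((i : nat), (j : nat)) \in [:: (0, 1); (1, 2); (2, 3); (3, 4); (1, 3)]).

Definition complement (G : sgraph) : sgraph :=
  sym_graph (fun x y : G => ~~ adj x y).

Definition join (G H : sgraph) : sgraph :=
  sym_graph (fun x y : G + H =>
    match x, y with
    | inl u, inl v => adj u v
    | inr u, inr v => adj u v
    | inl _, inr _ => true
    | inr _, inl _ => true
    end).

(* The spindle graph M_{3p+1}: the cycle u_0 u_1 ... u_{3p} u_0 together with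
   the chords u_{3i-3} u_{3i-1} and u_{3i-2} u_{3i}, for 1 <= i <= p; in other
   words p diamonds in a row, u_{3i-3} and u_{3i} being the two vertices of
   degree 2 of the i-th one, closed by the edge u_{3p} u_0.  There is no edge
   u_{3p} u_1 (= u_{3p} u_{3p+2}) when p >= 2, so that M_7 is the Moser
   spindle, with 11 edges. *)
Definition spindle (p : nat) : sgraph :=
  sym_graph (fun i j : 'I_(3 * p).+1 =>
    (j == ordS i) || ((j == i + 2 :> nat) && (i %% 3 != 2))).

(* The clique expansion C_p[k_1, ..., k_p], where p = size k >= 3; the vertices
   with tag i form the clique that replaces the (i+1)-st vertex of C_p. *)
Definition clique_expansion (k : seq nat) : sgraph :=
  sym_graph (fun x y : {i : 'I_(size k) & 'I_(nth 0 k i)} =>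
    (tag y == tag x) || (tag y == ordS (tag x))).

(* 2, ..., 2, 1, 3, 1, 3, ..., 3, 1 with a entries 2 and b entries 3. *)
Definition twos_then_alternating (a b : nat) : seq nat :=
  nseq a 2 ++ rcons (flatten (nseq b [:: 1; 3])) 1.

Definition twos_then_one (a : nat) : seq nat := rcons (nseq a 2) 1.

(* Main.v *)
(* If G has three pairwise nonadjacent vertices, connectedness yields an induced
   path on five vertices, and the vertices of G are classified by their
   neighborhoods on a longest induced path: G is a clique expansion of a path or
   of a cycle of length at least 6.  Such an expansion is 4-colorable, or contains
   K_5, or is an odd one whose class sizes are so tight that it has one of the
   forms in (iv).  If G has no three such vertices, consider a shortest odd cycle
   of its complement: there is none when the complement is bipartite, and then
   Hall's theorem gives a 4-coloring; length 3 is impossible, length 5 gives an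
   induced C_5, length at least 11 gives K_5, length 9 gives C_5[2,2,2,2,1], and
   length 7 leaves finitely many graphs on at most nine vertices.  Graphs with an
   induced C_5 and at most eight vertices are finitely many as well. *)

(* The alternative [K_5] is split off at the very start. From then on cliques have at most four
   vertices, so two consecutive classes of an expansion have at most four vertices together.
   Coloring odd classes from color 0 upwards and even ones from color 3 downwards then succeeds
   whenever parity is consistent around the cycle. Only odd cyclic expansions resist, and the repair
   of the parity defect at the closing class fails exactly for the size sequences made of 2, 1 and
   3.

   Five path vertices are needed because of the gem: a path on four vertices together with a vertex
   adjacent to all of them has neither a claw nor a bull, yet the additional vertex fits no class of
   an expansion along that path.

   The finite cases are decided by computation on boolean adjacency rows. They stay small because a
   new vertex is described by its adjacencies to a fixed pentagon or heptagon, forbidden induced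
   subgraphs leave few such types, and new vertices may be sorted by type. *)
Require Import Defs.
From mathcomp Require Import all_boot.
From mathcomp Require Import zify.

Set Implicit Arguments.
Unset Strict Implicit.
Unset Printing Implicit Defensive.

(** * Backtracking search for subgraphs and colorings *)

(* A graph on 0, ..., n-1 is encoded by its rows: the k-th one lists the
   adjacencies of k with k-1, ..., 0. *)
Definition row (P : rel nat) k := [seq P k j | j <- rev (iota 0 k)].
Definition rows (P : rel nat) n := [seq row P k | k <- iota 0 n].

Definition entry (M : seq (seq bool)) i j :=
  if j < i then nth false (nth [::] M i) (i - j.+1)
  else nth false (nth [::] M j) (j - i.+1).

Lemma nth_row P k j : j < k -> nth false (row P k) (k - j.+1) = P k j.
Proof.
move=> jk; rewrite (nth_map 0) ?size_rev ?size_iota; last lia.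
rewrite nth_rev ?size_iota; last lia.
rewrite nth_iota; last lia.
by have -> : 0 + (k - (k - j.+1).+1) = j by lia.
Qed.

Lemma entry_rows P n i j :
  symmetric P -> i < n -> j < n -> i != j -> entry (rows P n) i j = P i j.
Proof.
move=> Psym.
have E a b : b < a -> a < n -> nth false (nth [::] (rows P n) a) (a - b.+1) = P a b.
  by move=> ba an; rewrite (nth_map 0) ?size_iota // nth_iota // nth_row.
move=> iN jN ij; rewrite /entry; case: (ltnP j i) => h; first exact: (E i j h iN).
by rewrite (E j i) ?(Psym j) // ltn_neqAle ij.
Qed.

(* The boolean operators evaluate both arguments under vm_compute; a
   conditional does not. *)
Fixpoint has_lazy (a : pred nat) (s : seq nat) : bool :=
  if s is x :: s' then if a x then true else has_lazy a s' else false.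

Lemma has_lazyE a s : has_lazy a s = has a s.
Proof. by elim: s => //= x s ->. Qed.

Section Search.
Variables (ok : bool -> rel nat) (cand : seq nat).

(** [p] holds the images chosen so far, latest first. Rows are listed in the same descending order,
    so [zip r p] pairs each adjacency with the image that it concerns. *)
Fixpoint extend (R : seq (seq bool)) (p : seq nat) : bool :=
  if R is r :: R' then
    has_lazy (fun v => if all (fun bu => ok bu.1 v bu.2) (zip r p)
                       then extend R' (v :: p) else false) cand
  else true.

Lemma extendP P n p :
  extend [seq row P k | k <- iota (size p) n] p ->
  exists q : nat -> nat, (forall i, i < size p -> q i = nth 0 (rev p) i) /\
    forall i, size p <= i < size p + n ->
      q i \in cand /\ forall j, j < i -> ok (P i j) (q i) (q j).
Proof.
elim: n p => [|n IHn] p /=.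
  by exists (nth 0 (rev p)); split=> // i; rewrite addn0 ltnNge andbN.
rewrite has_lazyE; case/hasP=> v vc /andP[okv /(IHn (v :: p))[q [qp qn]]].
have qS i : i < size p -> q i = nth 0 (rev p) i.
  by move=> ip; rewrite qp ?ltnS ?(ltnW ip) //= rev_cons nth_rcons size_rev ip.
exists q; split=> // i; case/andP; rewrite leq_eqVlt => /predU1P[<- _|ip iN]; last first.
  by apply: qn => /=; rewrite ip addSnnS.
have -> : q (size p) = v.
  by rewrite qp //= rev_cons nth_rcons size_rev ltnn eqxx.
split=> // j jp; rewrite qS //.
move/(all_nthP (false, 0))/(_ (size p - j.+1)): okv.
rewrite size_zip size_map size_rev size_iota minnn => /(_ ltac:(lia)).
rewrite nth_zip ?size_map ?size_rev ?size_iota //= nth_row // nth_rev //.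
Qed.

Lemma search P n : extend (rows P n) [::] ->
  exists q : nat -> nat, forall i, i < n ->
    q i \in cand /\ forall j, j < i -> ok (P i j) (q i) (q j).
Proof. by case/(@extendP P n [::]) => q [_ qn]; exists q => i; apply: (qn i). Qed.
End Search.

Definition sub_ok M b v u := (v != u) && (b ==> entry M v u).
Definition ind_ok M b v u := (v != u) && (entry M v u == b).
Definition col_ok b (v u : nat) := b ==> (v != u).

Definition has_sub (R M : seq (seq bool)) := extend (sub_ok M) (iota 0 (size M)) R [::].
Definition has_ind (R M : seq (seq bool)) := extend (ind_ok M) (iota 0 (size M)) R [::].
(** Here the graph to be colored plays the role of the pattern, and the candidate images are the
    four colors. *)
Definition four_col M := extend col_ok (iota 0 4) M [::].

Section SearchGraph.
Variables (G : sgraph) (x0 : G) (s : seq G).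
Hypothesis s_uniq : uniq s.

Definition pattern : rel nat := fun i j => adj (nth x0 s i) (nth x0 s j).
Let M := rows pattern (size s).

Lemma pattern_sym : symmetric pattern.
Proof. by move=> i j; apply: adj_sym. Qed.

Lemma size_pattern : size M = size s.
Proof. by rewrite size_map size_iota. Qed.

Lemma gtn_inj (T : eqType) (g : nat -> T) n :
  (forall i j, i < n -> j < i -> g i != g j) -> {in gtn n &, injective g}.
Proof.
move=> gN i j iN jN e; case: (ltngtP i j) => // h.
  by move: (gN _ _ jN h); rewrite e eqxx.
by move: (gN _ _ iN h); rewrite e eqxx.
Qed.

Lemma has_subP P n : symmetric P -> has_sub (rows P n) M ->
  exists2 g : nat -> G, {in gtn n &, injective g} &
    forall i j, i < n -> j < n -> i != j -> P i j -> adj (g i) (g j).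
Proof.
move=> Psym /search[q]; rewrite size_pattern => qP.
have qlt i : i < n -> q i < size s by case/qP; rewrite mem_iota.
have H i j : i < n -> j < i ->
    q i != q j /\ (P i j -> adj (nth x0 s (q i)) (nth x0 s (q j))).
  move=> iN ji; have [_ /(_ j ji) /andP[d /implyP a]] := qP i iN; split=> // /a.
  by rewrite (entry_rows pattern_sym) ?qlt // (ltn_trans ji).
exists (fun i => nth x0 s (q i)).
  apply: gtn_inj => i j iN ji; have [d _] := H i j iN ji.
  by rewrite nth_uniq ?qlt // (ltn_trans ji).
move=> i j iN jN; rewrite neq_ltn => /orP[] h; last by case: (H i j iN h).
by rewrite Psym adj_sym; case: (H j i jN h).
Qed.

Lemma has_indP P n : symmetric P -> has_ind (rows P n) M ->
  exists2 g : nat -> G, {in gtn n &, injective g} &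
    forall i j, i < n -> j < n -> i != j -> adj (g i) (g j) = P i j.
Proof.
move=> Psym /search[q]; rewrite size_pattern => qP.
have qlt i : i < n -> q i < size s by case/qP; rewrite mem_iota.
have H i j : i < n -> j < i ->
    q i != q j /\ adj (nth x0 s (q i)) (nth x0 s (q j)) = P i j.
  move=> iN ji; have [_ /(_ j ji) /andP[d /eqP <-]] := qP i iN; split=> //.
  by rewrite (entry_rows pattern_sym) ?qlt // (ltn_trans ji).
exists (fun i => nth x0 s (q i)).
  apply: gtn_inj => i j iN ji; have [d _] := H i j iN ji.
  by rewrite nth_uniq ?qlt // (ltn_trans ji).
move=> i j iN jN; rewrite neq_ltn => /orP[] h; last by case: (H i j iN h).
by rewrite Psym adj_sym; case: (H j i jN h).
Qed.

Lemma four_colP : (forall x, x \in s) -> four_col M -> colorable G 4.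
Proof.
move=> s_all /search[q] qP.
have H i j : i < size s -> j < i -> adj (nth x0 s i) (nth x0 s j) -> q i != q j.
  by move=> iN ji; have [_ /(_ j ji) /implyP] := qP i iN.
exists (fun x => inord (q (index x s))) => x y xy.
have xs : index x s < size s by rewrite index_mem.
have ys : index y s < size s by rewrite index_mem.
have [[qx _] [qy _]] := (qP _ xs, qP _ ys); rewrite !mem_iota /= !add0n in qx qy.
rewrite -val_eqE /= !inordK //.
have : index x s != index y s.
  apply: contraTneq xy => e; rewrite -(nth_index x0 (s_all x)) e nth_index //.
  by rewrite adj_irrefl.
rewrite neq_ltn => /orP[] h; last by apply: H; rewrite ?nth_index.
by rewrite eq_sym; apply: H; rewrite ?nth_index // adj_sym.
Qed.
End SearchGraph.

Lemma contains_rank (G H : sgraph) n (P : rel nat) (rk : H -> nat) (g : nat -> G) :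
  injective rk -> (forall x, rk x < n) ->
  (forall x y, adj x y -> P (rk x) (rk y)) ->
  {in gtn n &, injective g} ->
  (forall i j, i < n -> j < n -> i != j -> P i j -> adj (g i) (g j)) ->
  contains G H.
Proof.
move=> rk_inj rk_lt HP g_inj gP; exists (g \o rk) => [x y /= /g_inj e|x y xy].
  by apply/rk_inj/e; apply: rk_lt.
apply: gP => //; last exact: HP.
by rewrite (inj_eq rk_inj); apply: contraTneq xy => ->; rewrite adj_irrefl.
Qed.

Lemma contains_induced_rank (G H : sgraph) n (P : rel nat) (rk : H -> nat) (g : nat -> G) :
  injective rk -> (forall x, rk x < n) ->
  (forall x y, x != y -> adj x y = P (rk x) (rk y)) ->
  {in gtn n &, injective g} ->
  (forall i j, i < n -> j < n -> i != j -> adj (g i) (g j) = P i j) ->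
  contains_induced G H.
Proof.
move=> rk_inj rk_lt HP g_inj gP; exists (g \o rk) => [x y /= /g_inj e|x y].
  by apply/rk_inj/e; apply: rk_lt.
have [->|xy] := eqVneq x y; first by rewrite !adj_irrefl.
by rewrite /= gP ?HP ?(inj_eq rk_inj).
Qed.

(** * The forbidden graphs as patterns *)

(** The patterns below are only read at two distinct indices, so their values on the diagonal are
    arbitrary. *)
Definition cyc n : rel nat := fun i j => (j == i.+1 %% n) || (i == j.+1 %% n).
Definition all_pat : rel nat := fun _ _ => true.
Definition claw_pat : rel nat := fun i j => (i == 0) (+) (j == 0).
Definition bull_edges := [:: (0, 1); (1, 2); (2, 3); (3, 4); (1, 3)].
Definition bull_pat : rel nat := fun i j => ((i, j) \in bull_edges) || ((j, i) \in bull_edges).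
Definition C5K2_pat : rel nat := fun i j => [|| 5 <= i, 5 <= j | cyc 5 i j].
Definition C7K1_pat : rel nat := fun i j => [|| 7 <= i, 7 <= j | ~~ cyc 7 i j].
Definition chord7 : rel nat := fun i j => (j == i.+1 %% 7) || ((j == i + 2) && (i %% 3 != 2)).
Definition M7K1_pat : rel nat := fun i j => [|| 7 <= i, 7 <= j, chord7 i j | chord7 j i].

Lemma cyc_sym n : symmetric (cyc n).
Proof. by move=> i j; rewrite /cyc orbC. Qed.

Definition join_rank m k (x : 'I_m + 'I_k) : nat :=
  match x with inl i => i | inr j => m + j end.

Lemma join_rank_inj m k : injective (@join_rank m k).
Proof.
move=> [i|i] [j|j] /= h.
- by congr inl; apply: val_inj.
- by have := ltn_ord i; lia.
- by have := ltn_ord j; lia.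
- by congr inr; apply: val_inj => /=; lia.
Qed.

Lemma join_rank_lt m k x : @join_rank m k x < m + k.
Proof. by case: x => i /=; have := ltn_ord i; lia. Qed.

Lemma adj_cycle n (i j : cycle_graph n) : adj i j = (i != j) && cyc n i j.
Proof. by []. Qed.

Lemma adj_join (G H : sgraph) (x y : join G H) :
  adj x y = match x, y with
            | inl u, inl v => adj u v
            | inr u, inr v => adj u v
            | _, _ => true
            end.
Proof.
case: x y => [x|x] [y|y] //=; rewrite /sym_adj /= (adj_sym y) orbb.
  have -> : (inl x == inl y :> G + H) = (x == y) by [].
  by case: eqP => // ->; rewrite adj_irrefl.
have -> : (inr x == inr y :> G + H) = (x == y) by [].
by case: eqP => // ->; rewrite adj_irrefl.
Qed.

Lemma adj_complement (G : sgraph) (x y : complement G) :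
  adj x y = (x != y) && ~~ adj (x : G) y.
Proof. by rewrite /= /sym_adj (adj_sym (y : G)) orbb. Qed.

Lemma no_claw_pat (G : sgraph) (g : nat -> G) : ~ contains_induced G claw ->
  {in gtn 4 &, injective g} ->
  (forall i j, i < 4 -> j < 4 -> i != j -> adj (g i) (g j) = claw_pat i j) -> False.
Proof.
move=> Gclaw g_inj gP; apply: Gclaw.
apply: (@contains_induced_rank G claw 4 claw_pat (@join_rank 1 3)) g_inj gP.
- exact: join_rank_inj.
- exact: join_rank_lt.
move=> [[[|//] x]|x] [[[|//] y]|y] // xy; last by rewrite /= /sym_adj andbF.
Qed.

Lemma no_bull_pat (G : sgraph) (g : nat -> G) : ~ contains_induced G bull ->
  {in gtn 5 &, injective g} ->
  (forall i j, i < 5 -> j < 5 -> i != j -> adj (g i) (g j) = bull_pat i j) -> False.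
Proof.
move=> Gbull g_inj gP; apply: Gbull.
apply: (@contains_induced_rank G bull 5 bull_pat val) g_inj gP.
- exact: val_inj.
- by move=> x; apply: ltn_ord.
- by move=> x y xy; rewrite /= /sym_adj xy.
Qed.

(** The spindle [M_4] is [K_4], so its join with one vertex is [K_5], whose edges the complete
    pattern covers. *)
Lemma contains_K5 (G : sgraph) (g : nat -> G) : {in gtn 5 &, injective g} ->
  (forall i j, i < 5 -> j < 5 -> i != j -> adj (g i) (g j)) ->
  contains G (join (spindle 1) (complete 1)).
Proof.
move=> g_inj gP.
apply: (@contains_rank G (join (spindle 1) (complete 1)) 5 all_pat (@join_rank (3 * 1).+1 1)).
- exact: join_rank_inj.
- exact: join_rank_lt.
- by [].
- exact: g_inj.
- by move=> i j *; apply: gP.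
Qed.

Lemma contains_C5K2 (G : sgraph) (g : nat -> G) : {in gtn 7 &, injective g} ->
  (forall i j, i < 7 -> j < 7 -> i != j -> C5K2_pat i j -> adj (g i) (g j)) ->
  contains G (join (cycle_graph 5) (complete 2)).
Proof.
apply: (@contains_rank G (join (cycle_graph 5) (complete 2)) 7 C5K2_pat (@join_rank 5 2)).
- exact: join_rank_inj.
- exact: join_rank_lt.
move=> [x|x] [y|y]; rewrite adj_join /C5K2_pat ?leq_addr ?orbT //.
by rewrite adj_cycle => /andP[_ ->]; rewrite !orbT.
Qed.

Lemma contains_C7K1 (G : sgraph) (g : nat -> G) : {in gtn 8 &, injective g} ->
  (forall i j, i < 8 -> j < 8 -> i != j -> C7K1_pat i j -> adj (g i) (g j)) ->
  contains G (join (complement (cycle_graph 7)) (complete 1)).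
Proof.
apply: (@contains_rank G (join (complement (cycle_graph 7)) (complete 1)) 8 C7K1_pat (@join_rank 7 1)).
- exact: join_rank_inj.
- exact: join_rank_lt.
move=> [x|x] [y|y]; rewrite adj_join /C7K1_pat ?leq_addr ?orbT //.
rewrite adj_complement adj_cycle => /andP[xy].
by rewrite xy /= => ->; rewrite !orbT.
Qed.

Lemma contains_M7K1 (G : sgraph) (g : nat -> G) : {in gtn 8 &, injective g} ->
  (forall i j, i < 8 -> j < 8 -> i != j -> M7K1_pat i j -> adj (g i) (g j)) ->
  contains G (join (spindle 2) (complete 1)).
Proof.
apply: (@contains_rank G (join (spindle 2) (complete 1)) 8 M7K1_pat (@join_rank (3 * 2).+1 1)).
- exact: join_rank_inj.
- exact: join_rank_lt.
move=> [x|x] [y|y]; rewrite adj_join /M7K1_pat ?leq_addr ?orbT //.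
by case/andP=> _ /orP[h|h]; [have -> : chord7 x y := h | have -> : chord7 y x := h];
  rewrite !orbT.
Qed.

(** * Small graphs with an induced pentagon *)

Fixpoint words (T : Type) n (s : seq T) : seq (seq T) :=
  if n is n'.+1 then [seq x :: w | x <- s, w <- words n' s] else [:: [::]].

Lemma mem_words (T : eqType) n (s w : seq T) :
  (w \in words n s) = (size w == n) && all (mem s) w.
Proof.
elim: n w => [|n IHn] [|x w] //=.
  by apply/allpairsP => -[[y v] /= []].
rewrite eqSS; apply/allpairsP/and3P => [[[y v] /= [ys vw [-> ->]]]|[sw xs ws]].
  by move: vw; rewrite IHn => /andP[-> ->]; rewrite ys.
by exists (x, w); split=> //; rewrite IHn sw.
Qed.

Definition bits n := words n [:: false; true].

Lemma mem_bits n w : (w \in bits n) = (size w == n).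
Proof. by rewrite mem_words; case: (_ == _) => //=; apply/allP=> -[]. Qed.

Fixpoint all_rows n : seq (seq (seq bool)) :=
  if n is n'.+1 then [seq rcons U b | U <- all_rows n', b <- bits n'] else [:: [::]].

Lemma rowsS P n : rows P n.+1 = rcons (rows P n) (row P n).
Proof. by rewrite /rows -addn1 iotaD map_cat cats1. Qed.

Lemma rows_all_rows P n : rows P n \in all_rows n.
Proof.
elim: n => // n IHn; rewrite rowsS; apply/allpairsP; exists (rows P n, row P n).
by rewrite mem_bits size_map size_rev size_iota.
Qed.

(* All ways of adding n vertices to the graph with rows B when the adjacencies
   of a new vertex to the old ones are listed in [types]; by symmetry, the new
   vertices may be assumed to come in the order of their types. *)
Definition extensions (B : seq (seq bool)) n (types : seq (seq bool)) :=
  [seq B ++ [seq ut.1 ++ ut.2 | ut <- zip U T] | U <- all_rows n,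
     T <- [seq T <- words n types | sorted leq [seq index t types | t <- T]]].

Section Types.
Variables (G : sgraph) (x0 : G) (s0 : seq G).

Definition type_on (x : G) := [seq adj x y | y <- rev s0].

(** Since rows run downwards, the row of a new vertex starts with its adjacencies inside [r] and
    ends with its type on [s0]. *)
Lemma rows_pattern_cat r :
  rows (pattern x0 (s0 ++ r)) (size (s0 ++ r)) =
  rows (pattern x0 s0) (size s0) ++
  [seq ut.1 ++ ut.2 | ut <- zip (rows (pattern x0 r) (size r)) (map type_on r)].
Proof.
rewrite /rows size_cat iotaD map_cat; congr cat.
  apply/eq_in_map => k; rewrite mem_iota => /andP[_ ks]; apply/eq_in_map => j.
  rewrite mem_rev mem_iota => /andP[_ jk]; rewrite /pattern !nth_cat ks.
  by rewrite (ltn_trans jk ks).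
apply: (@eq_from_nth _ [::]); rewrite size_map size_iota.
  by rewrite size_map size_zip !size_map size_iota minnn.
move=> k kr; rewrite (nth_map 0) ?size_iota // nth_iota //.
rewrite (nth_map ([::], [::])) ?size_zip ?size_map ?size_iota ?minnn //.
rewrite nth_zip ?size_map ?size_iota //= (nth_map 0) ?size_iota // nth_iota //.
rewrite /row add0n iotaD rev_cat map_cat add0n; congr cat.
  rewrite -[X in rev (iota X _)]addn0 iotaDl -map_rev -map_comp.
  by apply: eq_map => j /=; rewrite /pattern !nth_cat !ltnNge !leq_addr /= !addKn.
rewrite (nth_map x0) // /type_on -{4}(mkseq_nth x0 s0) /mkseq -map_rev -map_comp.
apply/eq_in_map => j; rewrite mem_rev mem_iota => /andP[_ /= js].
by rewrite /pattern !nth_cat ltnNge leq_addr addKn js.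
Qed.

Lemma mem_extensions types r :
  all (fun x => type_on x \in types) r ->
  sorted leq [seq index (type_on x) types | x <- r] ->
  rows (pattern x0 (s0 ++ r)) (size (s0 ++ r)) \in
    extensions (rows (pattern x0 s0) (size s0)) (size r) types.
Proof.
move=> r_types r_sorted; rewrite rows_pattern_cat; apply/allpairsP.
exists (rows (pattern x0 r) (size r), map type_on r); split=> //=.
  exact: rows_all_rows.
by rewrite mem_filter -map_comp r_sorted mem_words size_map eqxx all_map.
Qed.

Lemma sort_types types r :
  { r' | perm_eq r' r & sorted leq [seq index (type_on x) types | x <- r'] }.
Proof.
exists (sort (relpre (fun x => index (type_on x) types) leq) r).
  by rewrite perm_sort.
by rewrite sorted_map; apply: sort_sorted => x y; apply: leq_total.
Qed.
End Types.

Lemma eq_rows (P Q : rel nat) n :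
  (forall i j, j < i -> i < n -> P i j = Q i j) -> rows P n = rows Q n.
Proof.
move=> PQ; apply/eq_in_map => k; rewrite mem_iota => /andP[_ kn].
by apply/eq_in_map => j; rewrite mem_rev mem_iota => /andP[_ jk]; apply: PQ.
Qed.

Lemma connected_closed (G : sgraph) (A : pred G) x0 :
  connected G -> A x0 -> (forall x y, A x -> adj x y -> A y) -> forall x, A x.
Proof.
move=> Gconn A0 Aadj x; case/connectP: (Gconn x0 x) => p.
by elim: p x0 A0 => [|y p IHp] z Az /= => [_ ->|/andP[/(Aadj _ _ Az) Ay]] //; apply: IHp.
Qed.

Definition C5_rows := rows (cyc 5) 5.
Definition claw_rows := rows claw_pat 4.
Definition bull_rows := rows bull_pat 5.

Definition claw_or_bull M := has_ind claw_rows M || has_ind bull_rows M.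

(* Three or four consecutive vertices of the pentagon, or all of them. *)
Definition pentagon_types :=
  [seq t <- bits 5 | (true \in t) && ~~ claw_or_bull (rcons C5_rows t)].

Definition pentagon_concl M :=
  if four_col M then true
  else if has_sub (rows all_pat 5) M then true
  else if has_sub (rows C5K2_pat 7) M then true
  else has_sub (rows M7K1_pat 8) M.

(** A graph on at most eight vertices has at most three vertices outside the pentagon, whence
    [iota 0 4]. *)
Lemma pentagon_check :
  all (fun n => all pentagon_concl (extensions C5_rows n pentagon_types)) (iota 0 4).
Proof. by vm_compute. Qed.

(** The last row is a vertex adjacent to the vertex of type [t] but to none of the pentagon. As this
    forces a claw or a bull, connectedness makes the pentagon dominating. *)
Lemma pentagon_far_check :
  all (fun t => claw_or_bull (C5_rows ++ [:: t; true :: nseq 5 false])) pentagon_types.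
Proof. by vm_compute. Qed.

Lemma all_pat_sym : symmetric all_pat. Proof. by []. Qed.
Lemma claw_pat_sym : symmetric claw_pat. Proof. by move=> i j; rewrite /claw_pat addbC. Qed.
Lemma bull_pat_sym : symmetric bull_pat. Proof. by move=> i j; rewrite /bull_pat orbC. Qed.
Lemma C5K2_pat_sym : symmetric C5K2_pat.
Proof. by move=> i j; rewrite /C5K2_pat cyc_sym orbCA. Qed.
Lemma M7K1_pat_sym : symmetric M7K1_pat.
Proof. by move=> i j; rewrite /M7K1_pat orbCA [chord7 i j || _]orbC. Qed.

Section Pentagon.
Variables (G : sgraph) (f : cycle_graph 5 -> G).
Hypotheses (Gconn : connected G) (Gbull : ~ contains_induced G bull)
  (Gclaw : ~ contains_induced G claw).
Hypotheses (f_inj : injective f) (f_adj : forall x y, adj (f x) (f y) = adj x y).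

Let x0 := f (inord 0).
Let s0 : seq G := [seq f i | i <- [seq inord k | k <- iota 0 5]].

Lemma nth_s0 i : i < 5 -> nth x0 s0 i = f (inord i).
Proof.
move=> i5; rewrite (nth_map ord0) ?size_map ?size_iota //.
by rewrite (nth_map 0) ?size_iota // nth_iota.
Qed.

Lemma pentagon_uniq : uniq s0.
Proof.
rewrite map_inj_uniq // map_inj_in_uniq ?iota_uniq // => i j.
rewrite !mem_iota => /andP[_ i5] /andP[_ j5] e.
by rewrite -(inordK i5) e inordK.
Qed.

Lemma pentagon_rows : rows (pattern x0 s0) (size s0) = C5_rows.
Proof.
apply: eq_rows => i j ji i5; have j5 := ltn_trans ji i5.
rewrite /pattern !nth_s0 // f_adj adj_cycle -val_eqE /= !inordK //.
by rewrite neq_ltn ji orbT.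
Qed.

Lemma claw_or_bullF s : uniq s -> ~~ claw_or_bull (rows (pattern x0 s) (size s)).
Proof.
move=> s_uniq; apply/negP => /orP[] /(has_indP s_uniq)[] //.
- exact: claw_pat_sym.
- by move=> g; apply: no_claw_pat.
- exact: bull_pat_sym.
- by move=> g; apply: no_bull_pat.
Qed.

Lemma type_bits x : type_on s0 x \in bits 5.
Proof. by rewrite mem_bits. Qed.

Lemma mem_pentagon_types x : x \notin s0 -> true \in type_on s0 x ->
  type_on s0 x \in pentagon_types.
Proof.
move=> xs tx; rewrite mem_filter type_bits andbT tx /=.
have := @claw_or_bullF (s0 ++ [:: x]).
rewrite rows_pattern_cat pentagon_rows; apply.
by rewrite cat_uniq pentagon_uniq /= orbF xs.
Qed.

Lemma pentagon_dominates x : x \notin s0 -> true \in type_on s0 x.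
Proof.
move: x; suff H x : (x \in s0) || (true \in type_on s0 x).
  by move=> x /negPf xs; have := H x; rewrite xs.
apply: (connected_closed (A := fun x => (x \in s0) || (true \in type_on s0 x)) (x0 := x0)) => //.
  by have := mem_nth x0 (isT : 0 < size s0); rewrite nth_s0 // => ->.
move=> {}x y; case: (boolP (y \in s0)) => //= ys; case: (boolP (x \in s0)) => /= [xs _ xy|xs tx xy].
  by apply/mapP; exists x; rewrite ?mem_rev // adj_sym xy.
apply/negPn/negP => ty.
have ty0 : type_on s0 y = nseq 5 false.
  by apply/all_pred1P/allP => b bt; case: b bt ty => // ->.
have xy_uniq : uniq (s0 ++ [:: x; y]).
  rewrite cat_uniq pentagon_uniq /= (negPf xs) (negPf ys) /= inE andbT.
  by apply: contraTneq xy => ->; rewrite adj_irrefl.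
have := claw_or_bullF xy_uniq; rewrite rows_pattern_cat pentagon_rows => /negP; apply.
have /allP/(_ _ (mem_pentagon_types xs tx)) := pentagon_far_check.
by rewrite -[X in true :: X]ty0 -{1}xy adj_sym.
Qed.

Lemma pentagon_small : #|G| <= 8 ->
  [\/ contains G (join (cycle_graph 5) (complete 2)),
      contains G (join (spindle 1) (complete 1)),
      contains G (join (spindle 2) (complete 1)) | colorable G 4].
Proof.
move=> G8; have [r r_perm r_sorted] := sort_types s0 pentagon_types [seq x <- enum G | x \notin s0].
have r_mem x : (x \in r) = (x \notin s0) by rewrite (perm_mem r_perm) mem_filter mem_enum andbT.
have s_uniq : uniq (s0 ++ r).
  rewrite cat_uniq pentagon_uniq (perm_uniq r_perm) filter_uniq ?enum_uniq // andbT.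
  by apply/hasPn => x; rewrite r_mem.
have s_all x : x \in s0 ++ r by rewrite mem_cat r_mem orbN.
have r3 : size r < 4.
  have /eq_card : G =i s0 ++ r by move=> x; rewrite s_all.
  by move: G8; rewrite (card_uniqP s_uniq) size_cat /= => G8 e; lia.
have : pentagon_concl (rows (pattern x0 (s0 ++ r)) (size (s0 ++ r))).
  have /allP/(_ (size r)) := pentagon_check; rewrite mem_iota => /(_ r3)/allP; apply.
  rewrite -pentagon_rows; apply: mem_extensions r_sorted; apply/allP => x.
  by rewrite r_mem => xs; rewrite mem_pentagon_types ?pentagon_dominates.
rewrite /pentagon_concl; case: ifP => [/(four_colP s_all)|_]; first by constructor 4.
case: ifP => [/(has_subP s_uniq all_pat_sym)[g g_inj gP] _|_].
  by constructor 2; apply: contains_K5 g_inj _ => i j ? ? ?; apply: gP.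
case: ifP => [/(has_subP s_uniq C5K2_pat_sym)[g g_inj gP] _|_].
  by constructor 1; apply: contains_C5K2 g_inj gP.
move/(has_subP s_uniq M7K1_pat_sym)=> [g g_inj gP].
by constructor 3; apply: contains_M7K1 g_inj gP.
Qed.
End Pentagon.

(** * Induced paths in claw-free and bull-free graphs *)

(** With the reflexive closure of adjacency, the distinctness of the vertices of a claw or bull
    follows from the nonadjacencies, and two vertices of one class of an expansion need no separate
    case when they coincide. *)
Definition adjeq (G : sgraph) (x y : G) := (x == y) || adj x y.

Section AdjEq.
Variable G : sgraph.
Implicit Types x y : G.

Lemma adjeqC x y : adjeq x y = adjeq y x.
Proof. by rewrite /adjeq eq_sym adj_sym. Qed.

Lemma adjeqxx x : adjeq x x.
Proof. by rewrite /adjeq eqxx. Qed.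

Lemma adj_adjeq x y : adj x y -> adjeq x y.
Proof. by rewrite /adjeq => ->; rewrite orbT. Qed.

Lemma adjeq_adj x y : x != y -> adjeq x y = adj x y.
Proof. by rewrite /adjeq => /negPf ->. Qed.

Lemma adjE x y : adj x y = (x != y) && adjeq x y.
Proof. by have [->|/adjeq_adj] := eqVneq x y; first by rewrite adj_irrefl. Qed.

Lemma nadjeq x y : ~~ adjeq x y -> (x != y) /\ (adj x y = false).
Proof. by rewrite /adjeq negb_or => /andP[-> /negPf]. Qed.

Lemma nadjeq_neq x y : ~~ adjeq x y -> x != y.
Proof. by case/nadjeq. Qed.
End AdjEq.

Definition induced_path (G : sgraph) m (p : nat -> G) :=
  forall i j, i < m -> j < m -> adjeq (p i) (p j) = (i <= j.+1) && (j <= i.+1).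

Lemma connected_boundary (G : sgraph) (A : pred G) x0 x :
  connected G -> A x0 -> ~~ A x -> exists w u, [/\ A w, adj w u & ~~ A u].
Proof.
move=> Gconn A0 Ax; have [/existsP[w /existsP[u /and3P[]]]|no] :=
  boolP [exists w, exists u, [&& A w, adj w u & ~~ A u]]; first by exists w, u.
case/negP: Ax; apply: (connected_closed Gconn A0) => w u Aw wu.
apply: contraNT no => Au; apply/existsP; exists w; apply/existsP; exists u.
by rewrite Aw wu.
Qed.

Section ClawBullFree.
Variable G : sgraph.
Hypotheses (Gconn : connected G) (Gbull : ~ contains_induced G bull)
  (Gclaw : ~ contains_induced G claw).
Local Notation e := (@adjeq G).

Lemma no_claw c x y z : e c x -> e c y -> e c z ->
  ~~ e x y -> ~~ e x z -> ~~ e y z -> False.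
Proof.
move=> cx cy cz xy xz yz.
have nx : c != x by apply: contraNneq xy => <-.
have ny : c != y by apply: contraNneq yz => <-.
have nz : c != z by apply: contraNneq xz => <-; rewrite adjeqC.
apply: (@no_claw_pat G (nth c [:: c; x; y; z]) Gclaw) => [i j iN jN /eqP|].
  rewrite nth_uniq // => [/eqP//|]; rewrite /= !inE !negb_or nx ny nz.
  by rewrite !nadjeq_neq.
move: xy xz yz => /nadjeq[_ xy] /nadjeq[_ xz] /nadjeq[_ yz].
rewrite !adjeq_adj // in cx cy cz.
by move=> [|[|[|[|//]]]] [|[|[|[|//]]]] //= _ _ _; rewrite ?cx ?cy ?cz ?xy ?xz ?yz
  1?adj_sym ?cx ?cy ?cz ?xy ?xz ?yz.
Qed.

Lemma no_bull a b c x y : e a b -> e b c -> e a c ->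
  e x a -> ~~ e x b -> ~~ e x c -> e y b -> ~~ e y a -> ~~ e y c -> ~~ e x y -> False.
Proof.
move=> ab bc ac xa xb xc yb ya yc xy.
have nab : a != b by apply: contraNneq xb => <-.
have nbc : b != c by apply: contraNneq yc => <-.
have nac : a != c by apply: contraNneq xc => <-.
have nxa : x != a by apply: contraNneq xb => ->.
have nyb : y != b by apply: contraNneq yc => ->.
apply: (@no_bull_pat G (nth c [:: x; a; c; b; y]) Gbull) => [i j iN jN /eqP|].
  rewrite nth_uniq // => [/eqP//|]; rewrite /= !inE !negb_or nxa nac nab.
  by rewrite [c == b]eq_sym nbc [b == y]eq_sym nyb !nadjeq_neq // adjeqC.
move: xb xc ya yc xy => /nadjeq[_ xb] /nadjeq[_ xc] /nadjeq[_ ya] /nadjeq[_ yc] /nadjeq[_ xy].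
rewrite !adjeq_adj // in ab bc ac xa yb.
move=> [|[|[|[|[|//]]]]] [|[|[|[|[|//]]]]] //= _ _ _; rewrite /bull_pat /=;
  by rewrite ?(xa, ab, bc, ac, yb, xb, xc, ya, yc, xy) // adj_sym
             ?(xa, ab, bc, ac, yb, xb, xc, ya, yc, xy).
Qed.

Lemma induced_P5 a b c d f : e a b -> e b c -> e c d -> e d f ->
  ~~ e a c -> ~~ e a d -> ~~ e a f -> ~~ e b d -> ~~ e b f -> ~~ e c f ->
  exists p : nat -> G, induced_path 5 p.
Proof.
move=> ab bc cd df ac ad af bd bf cf; exists (nth a [:: a; b; c; d; f]).
move: ac ad af bd bf cf => /negPf ac /negPf ad /negPf af /negPf bd /negPf bf /negPf cf.
move=> [|[|[|[|[|//]]]]] [|[|[|[|[|//]]]]] //= _ _;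
  by rewrite ?(adjeqxx, ab, bc, cd, df, ac, ad, af, bd, bf, cf) // adjeqC
             ?(adjeqxx, ab, bc, cd, df, ac, ad, af, bd, bf, cf).
Qed.

Local Ltac esym := solve [assumption | rewrite adjeqC; assumption].

(** By connectedness some [w] dominated by the path [b y c] has a neighbor [u] that is not. Among
    the traces of [w] on the path, both ends or the middle alone give a claw, and one end with the
    middle gives a bull. A single end remains, and [u w] prolongs the path there. *)
Lemma P5_of_undominated_P3 b y c a : e b y -> e y c -> ~~ e b c ->
  ~~ e a b -> ~~ e a y -> ~~ e a c -> exists p : nat -> G, induced_path 5 p.
Proof.
move=> eby eyc bc ab ay ac.
have [||w [u [wD wu]]] := @connected_boundary G (fun x => [|| e x b, e x y | e x c]) b a Gconn.
- by rewrite adjeqxx.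
- by rewrite (negPf ab) (negPf ay).
case/norP=> ub /norP[uy uc]; have {}wu := adj_adjeq wu.
have [wb|wb] := boolP (e w b); have [wc|wc] := boolP (e w c).
- by exfalso; apply: (@no_claw w b c u); esym.
- have [wy|wy] := boolP (e w y).
    by exfalso; apply: (@no_bull w y b u c); esym.
  by apply: (@induced_P5 u w b y c); esym.
- have [wy|wy] := boolP (e w y).
    by exfalso; apply: (@no_bull w y c u b); esym.
  by apply: (@induced_P5 u w c y b); esym.
- rewrite (negPf wb) (negPf wc) orbF /= in wD.
  by exfalso; apply: (@no_claw y b c w); esym.
Qed.

(** Without a common neighbor, [v] is at distance at least three from [u]. Take an induced path
    [u z y] reaching distance two. If it does not dominate [v], the previous lemma applies;
    otherwise [v] is adjacent to [y], and a claw or bull shows that the path does not dominate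
    [w]. *)
Lemma P5_or_common_neighbor u v w : ~~ e u v -> ~~ e u w -> ~~ e v w ->
  (exists p : nat -> G, induced_path 5 p) \/ (exists2 x, e u x & e x v).
Proof.
move=> uv uw vw.
have [/existsP[x /andP[]]|far] := boolP [exists x, e u x && e x v].
  by move=> *; right; exists x.
have farv x : e u x -> ~~ e x v.
  by move=> ux; apply: contraNN far => xv; apply/existsP; exists x; rewrite ux.
left; have [||y [t []]] :=
  @connected_boundary G (fun x => [exists z, e u z && e z x]) u v Gconn.
- by apply/existsP; exists u; rewrite !adjeqxx.
- by [].
case/existsP=> z /andP[uz zy] /adj_adjeq yt /existsPn ut.
have uy : ~~ e u y by apply/negP => uy; have := ut y; rewrite uy yt.
have vz : ~~ e v z by rewrite adjeqC farv.
have vu : ~~ e v u by rewrite adjeqC.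
have wu : ~~ e w u by rewrite adjeqC.
have [vy|vy] := boolP (e v y); last exact: (@P5_of_undominated_P3 u z y v).
have [wz|wz] := boolP (e w z); have [wy|wy] := boolP (e w y).
- by exfalso; apply: (@no_bull z y w u v); esym.
- by exfalso; apply: (@no_claw z u y w); esym.
- by exfalso; apply: (@no_claw y z v w); esym.
- exact: (@P5_of_undominated_P3 u z y w).
Qed.

(** Common neighbors [x] of [a, b] and [y] of [b, c] give the path [a x b y c]: the chords [xc] and
    [ay] create claws, and the chord [xy] a bull. *)
Lemma P5_exists a b c : ~~ e a b -> ~~ e a c -> ~~ e b c ->
  exists p : nat -> G, induced_path 5 p.
Proof.
move=> ab ac bc; have [ba ca cb] : [/\ ~~ e b a, ~~ e c a & ~~ e c b].
  by split; rewrite adjeqC.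
have [//|[x ax xb]] := P5_or_common_neighbor ab ac bc.
have [//|[y eby yc]] := P5_or_common_neighbor bc ba ca.
have xc : ~~ e x c by apply/negP => xc; apply: (@no_claw x a b c); esym.
have ay : ~~ e a y by apply/negP => ay; apply: (@no_claw y a b c); esym.
have [xy|xy] := boolP (e x y); last exact: (@induced_P5 a x b y c).
by exfalso; apply: (@no_bull x y b a c); esym.
Qed.
End ClawBullFree.

Lemma maximal_path (G : sgraph) k (p : nat -> G) : induced_path k p ->
  exists m (q : nat -> G), [/\ k <= m, induced_path m q &
    forall r : nat -> G, ~ induced_path m.+1 r].
Proof.
pose has_path m := [exists q : {ffun 'I_m -> G}, [forall i : 'I_m, [forall j : 'I_m,
  adjeq (q i) (q j) == (i <= j.+1) && (j <= i.+1)]]].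
have pathP m : reflect (exists q : nat -> G, induced_path m q) (has_path m).
  apply: (iffP existsP) => [[q /forallP qP]|[q qP]].
    case: m q qP => [q _|m q qP]; first by exists p.
    exists (fun i => q (inord i)) => i j im jm.
    by have /forallP/(_ (inord j))/eqP -> := qP (inord i); rewrite !inordK.
  exists [ffun i : 'I_m => q i]; apply/forallP => i; apply/forallP => j.
  by rewrite !ffunE qP.
move=> kp; have kP : exists m, has_path m by exists k; apply/pathP; exists p.
have bounded m : has_path m -> m <= (2 * #|G|).+1.
  case/pathP=> q qP; rewrite leqNgt; apply/negP => mG.
  (* [induced_path] does not require consecutive vertices to be distinct, but those with different
     even indices are nonadjacent and distinct; hence the factor 2 in the bound. *)
  have q_inj : injective (fun i : 'I_#|G|.+1 => q (2 * i)).
    move=> i j qij; apply: val_inj; have iG := ltn_ord i; have jG := ltn_ord j.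
    have i2 : 2 * i < m by lia.
    have j2 : 2 * j < m by lia.
    by have := qP _ _ i2 j2; rewrite qij adjeqxx /=; lia.
  by have := leq_card _ q_inj; rewrite card_ord ltnn.
have [m m_path m_max] := ex_maxnP kP bounded.
have [q qP] := pathP m m_path; exists m, q; split=> //.
  by apply: m_max; apply/pathP; exists p.
by move=> r rP; have := m_max m.+1 (introT (pathP _) (ex_intro _ r rP)); rewrite ltnn.
Qed.

(* The intersection of a path p_0, ..., p_(m-1) with the closed neighborhood of
   p_i, for i < m, and of a vertex closing the path into a cycle, for i = m. *)
Definition path_type m i j :=
  if i < m then (i <= j.+1) && (j <= i.+1) else (j == 0) || (j.+1 == m).

(** * Neighborhoods on a longest induced path *)

Section LongestPath.
Variable G : sgraph.
Hypotheses (Gbull : ~ contains_induced G bull) (Gclaw : ~ contains_induced G claw).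
Local Notation e := (@adjeq G).
Variable m : nat.
Hypotheses (m5 : 5 <= m) (m_max : forall r : nat -> G, ~ induced_path m.+1 r).

Section Path.
Variables (p : nat -> G) (x : G).
Hypothesis p_path : induced_path m p.
Let t j := e x (p j).

Let pE i j : i < m -> j < m -> e (p i) (p j) = (i <= j.+1) && (j <= i.+1).
Proof. exact: p_path. Qed.

Local Ltac path_adj := solve [assumption | rewrite adjeqC; assumption | rewrite pE; lia].

Lemma type_interior j : j.+2 < m -> t j.+1 -> t j || t j.+2.
Proof.
move=> jm tj; apply/negPn/negP => /norP[t0 t2].
apply: (@no_claw _ Gclaw (p j.+1) x (p j) (p j.+2)); path_adj.
Qed.

Lemma type_no_triple i j k : i.+1 < j -> j.+1 < k -> k < m -> t i -> t j -> t k -> False.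
Proof.
move=> ij jk km ti tj tk.
by apply: (@no_claw _ Gclaw x (p i) (p j) (p k)); path_adj.
Qed.

Lemma type_no_pair i : i.+3 < m -> t i.+1 -> t i.+2 -> ~~ t i -> ~~ t i.+3 -> False.
Proof.
move=> im t1 t2 t0 t3.
apply: (@no_bull _ Gbull (p i.+1) (p i.+2) x (p i) (p i.+3)); path_adj.
Qed.

Lemma type_pair_left i j : i.+2 < m -> j < m -> (j.+1 < i) || (i.+3 < j) ->
  t i.+1 -> t i.+2 -> ~~ t i -> t j -> False.
Proof.
move=> im jm ij t1 t2 t0 tj.
apply: (@no_bull _ Gbull (p i.+1) x (p i.+2) (p i) (p j)); path_adj.
Qed.

Lemma type_pair_right i j : i.+2 < m -> j < m -> (j.+1 < i) || (i.+3 < j) ->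
  t i -> t i.+1 -> ~~ t i.+2 -> t j -> False.
Proof.
move=> im jm ij t1 t2 t0 tj.
apply: (@no_bull _ Gbull (p i.+1) x (p i) (p i.+2) (p j)); path_adj.
Qed.

(** Such a vertex put in front of the path would make it longer. *)
Lemma type_not_first : (forall j, j < m -> t j = (j == 0)) -> False.
Proof.
move=> t0; apply: (m_max (r := fun i => if i is i'.+1 then p i' else x)).
move=> [|i] [|j] im jm /=; rewrite ?adjeqxx ?pE //.
- by have := t0 j jm; rewrite /t => ->; lia.
- by have := t0 i im; rewrite /t adjeqC => ->; lia.
Qed.

Lemma type_not_last : (forall j, j < m -> t j = (j.+1 == m)) -> False.
Proof.
move=> t0; apply: (m_max (r := fun i => if i < m then p i else x)) => i j im jm /=.
case: ltnP => im'; case: ltnP => jm'; rewrite ?adjeqxx ?pE //.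
- by have := t0 i im'; rewrite /t adjeqC => ->; lia.
- by have := t0 j jm'; rewrite /t => ->; lia.
- by lia.
Qed.

(** Claws exclude an isolated interior neighbor and three pairwise distant ones. Bulls exclude a
    pair of consecutive neighbors with both outer sides missing, or with one side missing and a
    distant further neighbor. A lone end would prolong the path. What survives is three consecutive
    vertices, the first or last two, or both ends. *)
Lemma path_typeP : (exists2 j, j < m & t j) ->
  exists2 i, i <= m & forall j, j < m -> t j = path_type m i j.
Proof.
move=> [j0 j0m tj0].
have ex_t : exists j, (j < m) && t j by exists j0; rewrite j0m.
have [i /andP[im ti] i_min] := ex_minnP ex_t.
have {}i_min j : j < m -> t j -> i <= j by move=> jm tj; apply: i_min; rewrite jm.
have i_lt j : j < i -> ~~ t j.
  by move=> ji; apply/negP => /(i_min j (ltn_trans ji im)); lia.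
have [i1m|i1m] := ltnP i.+1 m; last first.
  by case: type_not_last => j jm; apply/idP/idP => [/(i_min j jm)|/eqP ?]; [lia|have ->
    : j = i by lia].
(* An isolated first neighbor must be the end [p 0]. The next neighbor [k] is then shown to be the
   other end, which is the type [m]. *)
have [ti1|ti1] := boolP (t i.+1); last first.
  case: i => [|i] in im ti i_min i_lt i1m ti1 *; last first.
    by have := type_interior i1m ti; rewrite (negPf ti1) orbF (negPf (i_lt i _)).
  have [/existsP[[k km] /andP[/= k0 tk]]|no] := boolP [exists k : 'I_m, (0 < k) && t k]; last first.
    case: type_not_first => -[|j] jm; first by rewrite ti.
    by apply/negbTE/negP => tj; case/existsP: no; exists (Ordinal jm).
  have ex_k : exists k, [&& 0 < k, k < m & t k] by exists k; rewrite k0 km.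
  have [{}k {km k0 tk} /and3P[k0 km tk] k_min] := ex_minnP ex_k.
  have k_lt j : 0 < j -> j < k -> ~~ t j.
    by move=> j0' jk; apply/negP => tj; have := k_min j; rewrite j0' tj (ltn_trans jk km) /=; lia.
  have [k1m|k1m] := ltnP k.+1 m; last first.
    exists m => // j jm; rewrite /path_type ltnn; apply/idP/idP => [tj|/orP[]/eqP jE].
    - have [->//|j0'] := posnP j; have := k_min j; rewrite j0' jm tj /= => /(_ isT).
      by lia.
    - by rewrite jE.
    - by have -> : j = k by lia.
  case: k => [//|[|k]] in k0 km tk k_min k_lt k1m *; first by rewrite tk in ti1.
  have := type_interior k1m tk; rewrite (negPf (k_lt k.+1 _ _)) //= => tk1.
  case: k => [|k] in k0 km tk k_min k_lt k1m tk1 *; last first.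
    by case: (@type_pair_left k.+2 0) => //; rewrite k_lt.
  have [t4|t4] := boolP (t 4); first by case: (@type_no_triple 0 2 4).
  by case: (@type_pair_right 2 0); rewrite // orbT.
have [i2m|i2m] := ltnP i.+2 m; last first.
  exists i.+1 => // j jm; rewrite /path_type i1m.
  apply/idP/idP => [/(i_min j jm)|jE]; first by lia.
  by have [->|->] : j = i \/ j = i.+1 by lia.
have [ti2|ti2] := boolP (t i.+2).
  have far j : i.+3 <= j -> j < m -> ~~ t j.
    move=> ij jm; apply/negP => tj.
    have [ij'|ij'] := ltnP i.+3 j; first by case: (@type_no_triple i i.+2 j).
    have {ij ij'}jE : j = i.+3 by lia.
    subst j; case: i => [|i] in im ti i_min i_lt i1m ti1 i2m ti2 jm tj *; last first.
      by case: (@type_pair_left i i.+4) => //; [lia|apply: i_lt].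
    have [t4|t4] := boolP (t 4); first by case: (@type_no_triple 0 2 4).
    by case: (@type_pair_right 2 0); rewrite // orbT.
  exists i.+1; first by lia.
  move=> j jm; rewrite /path_type i1m; apply/idP/idP => [tj|jE].
    have := i_min j jm tj; have [ij|ij] := leqP i.+3 j; last by lia.
    by rewrite (negPf (far j ij jm)) in tj.
  by have [->|[->|->]] : j = i \/ j = i.+1 \/ j = i.+2 by lia.
have far j : i.+3 <= j -> j < m -> ~~ t j.
  move=> ij jm; apply/negP => tj.
  case: i => [|i] in im ti i_min i_lt i1m ti1 i2m ti2 ij jm tj *; last first.
    by case: (@type_pair_left i j) => //; [lia|apply: i_lt].
  have [j3|j3] := ltnP 3 j; first by case: (@type_pair_right 0 j).
  have jE : j = 3 by lia.
  rewrite {}jE in tj; have := @type_interior 2 m5 tj.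
  by rewrite (negPf ti2) => t4; case: (@type_pair_right 0 4).
have two j : j < m -> t j -> (j == i) || (j == i.+1).
  move=> jm tj; have := i_min j jm tj; have [ij|ij] := leqP i.+3 j.
    by rewrite (negPf (far j ij jm)) in tj.
  have [jE|jE] := eqVneq j i.+2; last by lia.
  by rewrite jE (negPf ti2) in tj.
case: i => [|i] in im ti i_min i_lt i1m ti1 i2m ti2 far two *; last first.
  have [i3m|i3m] := ltnP i.+3 m; last by lia.
  by case: (@type_no_pair i) => //; apply: i_lt.
exists 0 => // j jm; rewrite /path_type im; apply/idP/idP => [/(two j jm)|]; first by lia.
by move=> j1; have [->|->] : j = 0 \/ j = 1 by lia.
Qed.
End Path.
End LongestPath.

(** * Blow-ups of cycles *)

Definition near n i j := (i == j) || cyc n i j.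

Lemma path_type_near m l i : 2 <= m -> l <= m -> i < m -> path_type m l i = near m.+1 l i.
Proof.
move=> m2 lm im; rewrite /path_type /near /cyc (@modn_small i.+1) ?ltnS //.
have [lm'|lm'] := ltnP l m; first by rewrite modn_small ?ltnS //; lia.
have -> : l = m by lia.
rewrite modnn; apply/idP/idP; lia.
Qed.

(** The types 0 and 1 differ only at 2, and the types [m - 2] and [m - 1] only at [m - 3]. Any other
    two distinct types differ in at least two places. *)
Lemma path_type_flip_lt m l k i : 5 <= m -> l < k -> k <= m -> i < m ->
  (forall j, j < m -> path_type m l j <> path_type m k j -> j = i) ->
  [\/ path_type m l i = path_type m k i, [/\ l = 0, k = 1 & i = 2] |
      [/\ l = m - 2, k = m - 1 & i = m - 3]].
Proof.
move=> m5 lk km im diff; have lm := leq_trans lk km.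
have [km'|km'] := ltnP k m; rewrite /path_type lm.
  rewrite /path_type lm km' in diff *.
  have [lk1|lk1] := ltnP l.+1 k.
    have := diff k km' ltac:(lia); have := diff l lm ltac:(lia); lia.
  have [l0|l0] := posnP l; first by constructor 2; have := diff 2 ltac:(lia) ltac:(lia); split; lia.
  have il := diff l.-1 ltac:(lia) ltac:(lia).
  have [k1|k1] := ltnP k.+1 m; first by have := diff k.+1 k1 ltac:(lia); lia.
  by constructor 3; split; lia.
have {km km'} kE : k = m by lia.
rewrite {}kE /path_type lm ltnn in diff *.
have [l0|l0] := posnP l.
  have := diff 1 ltac:(lia) ltac:(lia); have := diff m.-1 ltac:(lia) ltac:(lia); lia.
have [l1|l1] := eqVneq l.+1 m.
  have := diff 0 ltac:(lia) ltac:(lia); have := diff m.-2 ltac:(lia) ltac:(lia); lia.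
have il := diff l ltac:(lia) ltac:(lia).
have [l2|l2] := ltnP 1 l; first by have := diff l.-1 ltac:(lia) ltac:(lia); lia.
have := diff l.+1 ltac:(lia) ltac:(lia); lia.
Qed.

Lemma path_type_flip m l k i : 5 <= m -> l <= m -> k <= m -> i < m ->
  (forall j, j < m -> j != i -> path_type m l j = path_type m k j) ->
  path_type m k i = path_type m l i \/ [/\ l < m, l <= 1 & i = 2] \/
  [/\ l < m, m - 2 <= l & i = m - 3].
Proof.
move=> m5 lm km im same.
have diff l' k' : (forall j, j < m -> j != i -> path_type m l' j = path_type m k' j) ->
    forall j, j < m -> path_type m l' j <> path_type m k' j -> j = i.
  by move=> E j jm; case: (eqVneq j i) => // ji []; apply: E.
case: (ltngtP l k) => [lk|kl|->]; last by left.
  by case: (path_type_flip_lt m5 lk km im (diff _ _ same)) => [->|[-> ? ->]|[-> ? ->]];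
    [left|right; left|right; right]; split; lia.
have /(diff k l) {}diff : forall j, j < m -> j != i -> path_type m k j = path_type m l j.
  by move=> j jm ji; rewrite same.
by case: (path_type_flip_lt m5 kl lm im diff) => [->|[? -> ->]|[? -> ->]];
  [left|right; left|right; right]; split; lia.
Qed.

Lemma path_type_inj m i k : 5 <= m -> i < m -> k < m.+1 ->
  (forall j, j < m -> path_type m i j = path_type m k j) -> i = k.
Proof.
move=> m5 im km; rewrite /path_type im => same.
have [km'|km'] := ltnP k m; rewrite ltnS in km.
  rewrite km' in same; have iE := same i im; have kE := same k km'.
  case: (ltngtP i k) => // ik.
    have [k1|k1] := ltnP k.+1 m; first by have := same k.+1 k1; lia.
    by have := same i.-1 ltac:(lia); lia.
  have [i1|i1] := ltnP i.+1 m; first by have := same i.+1 i1; lia.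
  by have := same k.-1 ltac:(lia); lia.
rewrite ltnNge km' /= in same; have iE := same i im.
have [i0|i0] := posnP i; first by have := same 1 ltac:(lia); lia.
by have := same i.-1 ltac:(lia); lia.
Qed.

Lemma near_sym n : symmetric (near n).
Proof. by move=> i j; rewrite /near eq_sym cyc_sym. Qed.

Section Blowup.
Variable G : sgraph.
Hypotheses (Gbull : ~ contains_induced G bull) (Gclaw : ~ contains_induced G claw).
Local Notation e := (@adjeq G).
Variables (m : nat) (p : nat -> G).
Hypotheses (m5 : 5 <= m) (m_max : forall r : nat -> G, ~ induced_path m.+1 r)
  (p_path : induced_path m p).

Let of_type l x := forall j, j < m -> e x (p j) = path_type m l j.

Lemma replaced_path v i : i < m -> of_type i v ->
  induced_path m (fun j => if j == i then v else p j).
Proof.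
move=> im vi a b am bm; case: eqP => [->|ai]; case: eqP => [->|bi].
- by rewrite adjeqxx; lia.
- by rewrite vi // /path_type im.
- by rewrite adjeqC vi // /path_type im andbC.
- exact: p_path.
Qed.

(** Exchanging [p i] for [v] gives another longest path, on which [w] again has a type. This type
    [k] agrees with [l] away from [i], and its value at [i] tells whether [w] is adjacent to [v]. *)
Lemma replaced_type v w i l : i < m -> l <= m -> of_type i v -> of_type l w ->
  exists k, [/\ k <= m, e w v = path_type m k i &
    forall j, j < m -> j != i -> path_type m l j = path_type m k j].
Proof.
move=> im lm vi wl;
have [|k km kP] := path_typeP Gbull Gclaw m5 m_max (x := w) (replaced_path im vi).
  have [j [jm ji tj]] : exists j, [/\ j < m, j != i & path_type m l j].
    rewrite /path_type; have [lm'|lm'] := ltnP l m.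
      case: (eqVneq l i) => [->|li]; last by exists l; split=> //; lia.
      by have [i0|i0] := posnP i; [exists i.+1|exists i.-1]; split; lia.
    by have [i0|i0] := posnP i; [exists m.-1|exists 0]; split; lia.
  by exists j; rewrite // (negPf ji) wl.
exists k; split=> //; first by have := kP i im; rewrite eqxx.
by move=> j jm ji; have := kP j jm; rewrite (negPf ji) wl.
Qed.

(** The exchange determines the adjacency except near the ends of the path. Exchanging with the
    roles of [v] and [w] swapped has its own exceptions, and for [m >= 5] the two sets of exceptions
    are incompatible. *)
Lemma type_adj_path v w i l : i < m -> l <= m -> of_type i v -> of_type l w ->
  e w v = path_type m l i.
Proof.
move=> im lm vi wl; have [k [km wv kP]] := replaced_type im lm vi wl.
have [<-//|kli] := path_type_flip m5 lm km im kP.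
have lm' : l < m by case: kli => -[].
have [k' [km' vw kP']] := replaced_type lm' (ltnW im) wl vi.
have [E|kil] := path_type_flip m5 (ltnW im) km' lm' kP'.
  by rewrite adjeqC vw E /path_type im lm' andbC.
by case: kli => -[_ ? ?]; case: kil => -[_ ? ?]; lia.
Qed.

Lemma type_adj v w i l : i <= m -> l <= m -> of_type i v -> of_type l w ->
  e w v = near m.+1 l i.
Proof.
move=> im lm vi wl; have m2 : 2 <= m by apply: leq_trans m5.
have [im'|im'] := ltnP i m; first by rewrite -path_type_near // (type_adj_path im' lm vi wl).
have [lm'|lm'] := ltnP l m.
  by rewrite adjeqC near_sym -path_type_near // (type_adj_path lm' im wl vi).
have [iE lE] : i = m /\ l = m by split; lia.
rewrite iE lE /near eqxx /=; rewrite {}iE {}lE in vi wl.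
apply/negPn/negP => wv; have p01 : 1 < m by lia.
have [p0 p1] : 0 < m /\ 1 < m by split; lia.
(* Two nonadjacent vertices that both close the path would form a claw with [p 0] and [p 1]. *)
apply: (@no_claw _ Gclaw (p 0) w v (p 1)) => //.
- by rewrite adjeqC wl // /path_type ltnn.
- by rewrite adjeqC vi // /path_type ltnn.
- by rewrite p_path.
- by rewrite wl // /path_type ltnn; lia.
- by rewrite vi // /path_type ltnn; lia.
Qed.

(** The path dominates the graph. If a neighbor [y] of a dominated [x] were not dominated, [x] would
    be the center of a claw on [y] and two path vertices, unless [x] has the type of an end; then
    [y] prolongs the path in which [x] replaces that end. *)
Lemma type_exists x : connected G -> exists2 l, l <= m & of_type l x.
Proof.
move=> Gconn; have m0 : 0 < m by lia.
suff /existsP[i xi] : [exists i : 'I_m, e x (p i)].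
  by apply: (path_typeP Gbull Gclaw m5 m_max p_path); exists i.
apply: (@connected_closed _ (fun x => [exists i : 'I_m, e x (p i)]) (p 0)) => //.
  by apply/existsP; exists (Ordinal m0); apply: adjeqxx.
move=> {}x y /existsP[i xi] /adj_adjeq xy.
have [//|/existsPn yP] := boolP [exists i : 'I_m, e y (p i)]; exfalso.
have [|l lm xl] := path_typeP Gbull Gclaw m5 m_max (x := x) p_path; first by exists i.
have claw j k : j.+1 < k -> k < m -> path_type m l j -> path_type m l k -> False.
  move=> jk km tj tk; have jm := ltn_trans (ltnW jk) km.
  apply: (@no_claw _ Gclaw x y (p j) (p k)) => //; rewrite ?xl //.
  - exact: (yP (Ordinal jm)).
  - exact: (yP (Ordinal km)).
  - by rewrite p_path //; lia.
have y_new i' : i' < m -> of_type i' x ->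
    forall j, j < m -> e y (if j == i' then x else p j) = (j == i').
  move=> im xi' j jm; case: eqP => ji; first by rewrite adjeqC.
  exact/negbTE/(yP (Ordinal jm)).
case: (ltngtP l m) lm => // [lm _|lE _]; last first.
  by apply: (claw 0 m.-1); rewrite /path_type ?lE ?ltnn; lia.
have [l0|l0] := posnP l.
  rewrite {}l0 in xl lm *.
  exact: (type_not_first m5 m_max (replaced_path lm xl) (y_new _ lm xl)).
have [l1|l1] := ltnP l.+1 m.
  by apply: (claw l.-1 l.+1); rewrite /path_type ?lm; lia.
apply: (type_not_last m5 m_max (x := y) (replaced_path lm xl)) => j jm.
by rewrite y_new //; lia.
Qed.
End Blowup.

(** Paths and cycles are treated together: [n] is the path length plus one, and the last class holds
    the vertices closing the path into a cycle. It may be empty, which is the case of a path; hence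
    surjectivity onto all indices but the last. *)
Lemma cycle_blowup (G : sgraph) a b c : connected G ->
  ~ contains_induced G bull -> ~ contains_induced G claw ->
  ~~ @adjeq G a b -> ~~ adjeq a c -> ~~ adjeq b c ->
  exists n (f : G -> nat), [/\ 6 <= n, forall x, f x < n,
    forall x y, adjeq x y = near n (f x) (f y) &
    forall i, i.+1 < n -> exists x, f x = i].
Proof.
move=> Gconn Gbull Gclaw ab ac bc.
have [p5 /maximal_path[m [p [m5 p_path m_max]]]] := P5_exists Gconn Gbull Gclaw ab ac bc.
have typeP x : exists l : 'I_m.+1, [forall j : 'I_m, adjeq x (p j) == path_type m l j].
  have [l lm xl] := type_exists Gbull Gclaw m5 m_max p_path x Gconn.
  by exists (inord l); apply/forallP => j; rewrite inordK // xl.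
have typeE x j : j < m -> adjeq x (p j) = path_type m (xchoose (typeP x)) j.
  by move=> jm; have /forallP/(_ (Ordinal jm))/eqP := xchooseP (typeP x).
have le_m x : xchoose (typeP x) <= m by rewrite -ltnS ltn_ord.
exists m.+1, (fun x => val (xchoose (typeP x))); split=> // [x y|i im].
- exact: (type_adj Gbull Gclaw m5 m_max p_path (le_m y) (le_m x) (typeE y) (typeE x)).
- rewrite ltnS in im; exists (p i); apply/eqP; case: eqP => // /eqP ne.
case/eqP: ne; apply/esym/(path_type_inj m5 im (ltn_ord _)) => j jm.
by rewrite -typeE // p_path // /path_type im.
Qed.

(** * Colorings of blow-ups *)

Lemma colorable_nat (G : sgraph) k (c : G -> nat) : (forall x, c x < k) ->
  (forall x y, adj x y -> c x != c y) -> colorable G k.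
Proof.
move=> ck cP; exists (fun x => Ordinal (ck x)) => x y /cP.
by apply: contra => /eqP[->].
Qed.

Lemma clique_le4 (G : sgraph) (A : {set G}) :
  ~ contains G (join (spindle 1) (complete 1)) ->
  {in A &, forall x y, adjeq x y} -> #|A| <= 4.
Proof.
move=> noK5 Acl; rewrite leqNgt; apply/negP => A5; apply: noK5.
have /card_gt0P[x0 _] : 0 < #|A| by apply: leq_trans A5.
have nthA i : i < 5 -> nth x0 (enum A) i \in A.
  by move=> i5; rewrite -mem_enum mem_nth // -cardE (leq_trans i5).
have nth_inj i j : i < 5 -> j < 5 -> (nth x0 (enum A) i == nth x0 (enum A) j) = (i == j).
  by move=> i5 j5; rewrite nth_uniq ?enum_uniq // -cardE (leq_trans _ A5).
apply: (@contains_K5 _ (nth x0 (enum A))) => [i j i5 j5 /eqP|i j i5 j5 ij].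
  by rewrite nth_inj // => /eqP.
by rewrite adjE nth_inj // ij Acl ?nthA.
Qed.

Section Classes.
Variables (G : sgraph) (n : nat).
Implicit Type f : G -> nat.

Definition fiber f i := [set x | f x == i].
Definition rank f x := index x (enum (fiber f (f x))).

Lemma rank_lt f x : rank f x < #|fiber f (f x)|.
Proof. by rewrite cardE index_mem mem_enum inE. Qed.

Lemma rank_inj f x y : f x = f y -> rank f x = rank f y -> x = y.
Proof.
rewrite /rank => fxy; rewrite fxy => r.
have xin : x \in enum (fiber f (f y)) by rewrite mem_enum inE fxy.
have yin : y \in enum (fiber f (f y)) by rewrite mem_enum inE.
by rewrite -(nth_index x xin) r nth_index.
Qed.

Definition blowup f :=
  (forall x, f x < n) /\ (forall x y, adjeq x y = near n (f x) (f y)).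

Hypothesis n3 : 2 < n.
Hypothesis noK5 : ~ contains G (join (spindle 1) (complete 1)).

Lemma fiber_le4 f i : blowup f -> #|fiber f i| <= 4.
Proof.
move=> [_ fP]; apply: clique_le4 => // x y; rewrite !inE => /eqP xi /eqP yi.
by rewrite fP xi yi /near eqxx.
Qed.

Lemma fibers_le4 f i j : blowup f -> i != j -> cyc n i j ->
  #|fiber f i| + #|fiber f j| <= 4.
Proof.
move=> [_ fP] ij cij; rewrite -cardsUI.
have -> : fiber f i :&: fiber f j = set0.
  apply/setP => x; rewrite !inE; apply/negP => /andP[/eqP -> ji]; by rewrite ji in ij.
rewrite cards0 addn0; apply: clique_le4 => // x y; rewrite !inE fP /near.
by move=> /orP[] /eqP -> /orP[] /eqP ->; rewrite ?eqxx ?cij ?orbT // cyc_sym cij orbT.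
Qed.

Lemma adj_fibers f x y : blowup f -> adj x y ->
  f x = f y /\ rank f x != rank f y \/ f x != f y /\ cyc n (f x) (f y).
Proof.
move=> [_ fP]; rewrite adjE fP /near => /andP[xy].
case: eqVneq => [fxy _|fxy /= cxy]; [left|by right].
by split=> //; apply: contra_neq xy; apply: rank_inj.
Qed.

Lemma cyc_cases i j : i < n -> j < n -> cyc n i j ->
  [\/ j = i.+1, i = j.+1, i = n.-1 /\ j = 0 | j = n.-1 /\ i = 0].
Proof.
have E a b : a < n -> b == a.+1 %% n -> b = a.+1 \/ a = n.-1 /\ b = 0.
  move=> an /eqP ->; case: (ltngtP a.+1 n) => [a1|a1|a1]; first by left; rewrite modn_small.
    by lia.
  by right; rewrite a1 modnn; split=> //; lia.
move=> im jm /orP[/(E i j im)|/(E j i jm)] [?|?].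
- by constructor 1.
- by constructor 3.
- by constructor 2.
- by constructor 4.
Qed.

(** Odd classes use the colors from 0 upwards and even ones from 3 downwards; two consecutive
    classes do not collide as they have at most four vertices together. Consecutive classes have
    opposite parity, except for the last and the first when [n] is odd. *)
Lemma parity_colorable f : blowup f ->
  ~~ odd n \/ (forall x, f x != n.-1) -> colorable G 4.
Proof.
move=> fB parity; have [f_lt _] := fB.
have r_lt x : rank f x <= 3 by have := rank_lt f x; have := fiber_le4 (f x) fB; lia.
apply: (@colorable_nat _ 4 (fun x => if odd (f x) then rank f x else 3 - rank f x)).
  by move=> x; have := r_lt x; case: ifP; lia.
move=> x y /(adj_fibers fB)[[fxy rxy]|[fxy cxy]].
  by rewrite fxy; have := r_lt x; have := r_lt y; case: ifP; lia.
have odd_xy : odd (f x) != odd (f y).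
  have nfx : (f x != n.-1) \/ ~~ odd n by case: parity => h; [right|left; apply: h].
  have nfy : (f y != n.-1) \/ ~~ odd n by case: parity => h; [right|left; apply: h].
  by case: (cyc_cases (f_lt x) (f_lt y) cxy); lia.
have := fibers_le4 fB fxy cxy; have := rank_lt f x; have := rank_lt f y.
by move: odd_xy; case: (odd (f x)); case: (odd (f y)) => //=; lia.
Qed.

(* With the last class of size one, color 0 is given to one vertex in every
   second class, skipping the classes j and j+1; what remains is a blow-up of a
   path in which consecutive classes have at most 3 vertices. *)
Definition zero_class j i := if i <= j then odd i else ~~ odd i.
Definition odd_color j i r :=
  if zero_class j i && (r == 0) then 0
  else if odd i then (r - zero_class j i).+1 else 3 - (r - zero_class j i).

(** Of two consecutive classes other than [j, j.+1], one gives a vertex to color 0, so at most three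
    vertices share the colors 1 to 3. For the pair [j, j.+1] this bound is the hypothesis. *)
Lemma odd_colorable f j : blowup f -> odd n ->
  (forall i, i < n -> 0 < #|fiber f i|) -> #|fiber f n.-1| = 1 ->
  ~~ odd j -> j.+1 < n -> #|fiber f j| + #|fiber f j.+1| <= 3 -> colorable G 4.
Proof.
move=> fB n_odd f_gt0 f_last j_even jn j3; have [f_lt _] := fB.
have pair i : i.+1 < n -> #|fiber f i| + #|fiber f i.+1| <= 4.
  move=> i1; apply: (fibers_le4 fB); first by rewrite neq_ltn ltnSn.
  by rewrite /cyc modn_small // eqxx.
have f_le3 i : i < n -> #|fiber f i| <= 3.
  move=> im; have [i1|i1] := ltnP i.+1 n; first by have := pair i i1; have := f_gt0 _ i1; lia.
  have -> : i = n.-1 by lia.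
  by rewrite f_last.
apply: (@colorable_nat _ 4 (fun x => odd_color j (f x) (rank f x))).
  move=> x; rewrite /odd_color; have := rank_lt f x; have := f_le3 _ (f_lt x).
  by case: ifP => //; case: ifP => //; lia.
have step x y : f y = (f x).+1 ->
    odd_color j (f x) (rank f x) != odd_color j (f y) (rank f y).
  move=> fxy; have := rank_lt f x; have := rank_lt f y; rewrite fxy.
  have := f_lt y; rewrite fxy => x1; have := pair _ x1.
  have := f_le3 _ x1; have := f_le3 _ (ltnW x1).
  move: (rank f x) (rank f y) => r r'; rewrite /odd_color /zero_class /=.
  have [xj|xj] := eqVneq (f x) j.
    by rewrite xj leqnn ltnn /= (negPf j_even) /=; lia.
  have -> : (f x < j) = (f x <= j) by lia.
  by case: (f x <= j); case: (odd (f x)) => /=; case: eqP; case: eqP; lia.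
(* The last index is even and beyond [j], so its single vertex has color 0; class 0 is not a zero
   class and avoids that color. *)
have wrap x y : f x = n.-1 -> f y = 0 ->
    odd_color j (f x) (rank f x) != odd_color j (f y) (rank f y).
  move=> fx fy; have := rank_lt f x; have := rank_lt f y; have := f_le3 _ (f_lt y).
  rewrite fx fy f_last /odd_color /zero_class /= => *.
  have -> : n.-1 <= j = false by lia.
  have -> : odd n.-1 = false by lia.
  have -> : rank f x == 0 by lia.
  by rewrite /=; lia.
move=> x y /(adj_fibers fB)[[fxy rxy]|[fxy cxy]].
  have := rank_lt f x; have := rank_lt f y; have := f_le3 _ (f_lt y); rewrite fxy.
  move: rxy; move: (rank f x) (rank f y) => r r'; rewrite /odd_color.
  by case: (zero_class j (f y)); case: (odd (f y)) => /=;
    case: (r =P 0); case: (r' =P 0); lia.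
case: (cyc_cases (f_lt x) (f_lt y) cxy) => [/step//|/step|[xn y0]|[yn x0]].
- by rewrite eq_sym.
- exact: wrap.
- by rewrite eq_sym; apply: wrap.
Qed.

Lemma contains_clique_expansion f ks (x0 : G) : blowup f -> size ks = n ->
  (forall i, i < n -> nth 0 ks i <= #|fiber f i|) -> contains G (clique_expansion ks).
Proof.
move=> [_ fP] ks_n ks_le.
pose g (x : clique_expansion ks) := nth x0 (enum (fiber f (tag x))) (tagged x).
have g_lt (x : clique_expansion ks) : tagged x < #|fiber f (tag x)|.
  by apply: leq_trans (ltn_ord _) (ks_le _ _); rewrite -ks_n.
have fg x : f (g x) = tag x.
  apply/eqP; have : g x \in fiber f (tag x) by rewrite -mem_enum mem_nth // -cardE.
  by rewrite inE.
have g_inj : injective g.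
  move=> x y gxy; have := fg x; rewrite gxy fg => /val_inj.
  case: x y gxy => [i r] [j s] /= gxy ji; subst j; congr existT; apply: val_inj.
  have := @nth_uniq _ x0 (enum (fiber f i)) r s; rewrite -cardE.
  move=> /(_ (g_lt (existT _ i r)) (g_lt (existT _ i s)) (enum_uniq _)) rs.
  by apply/eqP; rewrite -rs; apply/eqP.
exists g => // x y /=; rewrite /sym_adj => /andP[xy txy].
rewrite adjE (inj_eq g_inj) xy fP !fg /near /cyc -ks_n /=.
by case/orP: txy => /orP[] /eqP ->; rewrite eqxx ?orbT.
Qed.

Lemma nth_alternating b i : nth 0 (rcons (flatten (nseq b [:: 1;
  3])) 1) i <= if odd i then 3 else 1.
Proof. by elim: b i => [|b IHb] [|[|i]] //=; rewrite negbK. Qed.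

Lemma size_twos_then_alternating a b : size (twos_then_alternating a b) = a + (2 * b).+1.
Proof.
rewrite size_cat size_nseq size_rcons; congr (_ + _.+1).
by elim: b => //= b ->; lia.
Qed.

Lemma nth_twos_then_alternating a b i :
  nth 0 (twos_then_alternating a b) i <= if i < a then 2 else if odd (i - a) then 3 else 1.
Proof.
rewrite nth_cat size_nseq; case: ifP => _; last exact: nth_alternating.
by rewrite nth_nseq; case: ifP.
Qed.

Definition expansion_case :=
  exists (i : nat) (k : seq nat),
    [/\ 1 <= i, size k = 2 * i + 1,
        (exists a b : nat, ~~ odd a /\ k = twos_then_alternating a b)
        \/ (exists a : nat, k = twos_then_one a)
      & contains G (clique_expansion k)].

(** Tightness gives [h (2j) + h (2j+1) = 4], while [h (2j+1) + h (2j+2) <= 4]. So the sizes of the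
    even classes do not increase; they start at most at 2 and end at 1, and the odd classes are
    their complements to 4. *)
Lemma tight_expansion f : blowup f -> odd n ->
  (forall i, i < n -> 0 < #|fiber f i|) -> #|fiber f n.-1| = 1 -> #|fiber f 0| <= 2 ->
  (forall j, ~~ odd j -> j.+1 < n -> 4 <= #|fiber f j| + #|fiber f j.+1|) ->
  expansion_case.
Proof.
move=> fB n_odd f_gt0 f_last f0 tight; set h := fun i => #|fiber f i|.
have [x0 _] : exists x, x \in fiber f 0 by apply/card_gt0P/f_gt0; lia.
have pair i : i.+1 < n -> h i + h i.+1 <= 4.
  move=> i1; apply: (fibers_le4 fB); first by rewrite neq_ltn ltnSn.
  by rewrite /cyc modn_small // eqxx.
have [s sn] : exists s, n = (2 * s).+1 by exists n./2; lia.
have s2 : 2 * s = n.-1 by lia.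
(* [b] is where the even classes drop from 2 to 1, so the sequence starts with [2 * b] twos. *)
have ex_b : exists b, h (2 * b) != 2 by exists s; rewrite /h s2 f_last.
have [b hb b_min] := ex_minnP ex_b.
have bs : b <= s by apply: b_min; rewrite /h s2 f_last.
have h_pair j : j < s -> h (2 * j).+1 = 4 - h (2 * j).
  move=> js; have := tight (2 * j); rewrite oddM /= => /(_ isT).
  by have := pair (2 * j); rewrite /h; lia.
have two j : j < b -> h (2 * j) = 2.
  by move=> jb; apply/eqP; apply: contraTT jb => /b_min; rewrite -leqNgt.
have h_gt0 i : i < n -> 0 < h i by apply: f_gt0.
have one j : b <= j -> j <= s -> h (2 * j) = 1.
  elim: j => [|j IHj] bj js.
    have b0 : b = 0 by lia.
    by move: hb f0 (h_gt0 0); rewrite b0 muln0 /h; lia.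
  have := pair (2 * j).+1; have := h_pair j js; have -> : (2 * j).+2 = 2 * j.+1 by lia.
  have := h_gt0 (2 * j.+1); have [bj'|bj'] := leqP b j; first by have := IHj bj' (ltnW js); lia.
  have bE : b = j.+1 by lia.
  by have := two j bj'; move: hb; rewrite bE; lia.
exists s, (twos_then_alternating (2 * b) (s - b)); split.
- by lia.
- by rewrite size_twos_then_alternating; lia.
- by left; exists (2 * b), (s - b); rewrite oddM.
apply: (contains_clique_expansion x0 fB); first by rewrite size_twos_then_alternating; lia.
move=> i im; apply: leq_trans (nth_twos_then_alternating _ _ _) _; rewrite -/(h i).
have [j iE] : exists j, i = 2 * j + odd i by exists i./2; lia.
have [ib|ib] := ltnP i (2 * b).
  have jb : j < b by lia.
  have := two j jb; have := h_pair j; move: iE; case: (odd i) => ->; rewrite ?addn0 ?addn1; lia.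
rewrite oddB // oddM /= addbF; move: iE; case: (odd i) => iE.
  by rewrite iE addn1 h_pair ?one //; lia.
by rewrite iE addn0 one //; lia.
Qed.

Lemma twos_expansion f : blowup f -> odd n -> (forall i, i < n -> 2 <= #|fiber f i|) ->
  expansion_case.
Proof.
move=> fB n_odd f_ge2.
have [x0 _] : exists x, x \in fiber f 0 by apply/card_gt0P/(leq_trans _ (f_ge2 _ _)); lia.
exists n./2, (twos_then_one n.-1); rewrite size_rcons size_nseq; split; try lia.
  by right; exists n.-1.
apply: (contains_clique_expansion x0 fB); first by rewrite size_rcons size_nseq; lia.
move=> i im; apply: leq_trans (f_ge2 i im); rewrite nth_rcons size_nseq nth_nseq.
by case: ifP => // _; case: ifP.
Qed.

Definition rotate s (f : G -> nat) x := (f x + s) %% n.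

Lemma near_modD i j s : i < n -> j < n -> near n ((i + s) %% n) ((j + s) %% n) = near n i j.
Proof.
move=> im jm; rewrite /near /cyc -!(addn1 (_ %% n)) !modnDml.
rewrite -!addnA ![s + 1]addnC !addnA !addn1 !eqn_modDr.
by rewrite (modn_small im) (modn_small jm).
Qed.

Lemma rotate_blowup s f : blowup f -> blowup (rotate s f).
Proof.
move=> [f_lt fP]; split=> [x|x y]; first by rewrite ltn_mod; lia.
by rewrite near_modD.
Qed.

Lemma rotate_fiber s f i : blowup f -> i < n ->
  fiber (rotate s f) ((i + s) %% n) = fiber f i.
Proof.
move=> [f_lt _] im; apply/setP => x; rewrite !inE /rotate eqn_modDr.
by rewrite (modn_small im) (modn_small (f_lt x)).
Qed.

(** If some class is a singleton, there is one whose successor has at most two vertices; it is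
    rotated to the last place. Then either a pair of classes has room, which gives a coloring, or
    all of them are tight. *)
Lemma odd_blowup f : blowup f -> odd n ->
  (forall i, i < n -> 0 < #|fiber f i|) -> expansion_case \/ colorable G 4.
Proof.
move=> fB n_odd f_gt0.
have [[z zn fz]|f_ge2] : (exists2 z, z < n & #|fiber f z| = 1) \/ (forall i, i < n ->
  2 <= #|fiber f i|).
  have [/existsP[z /eqP]|no] := boolP [exists z : 'I_n, #|fiber f z| == 1]; [left|right].
    by exists z.
  move=> i im; have := f_gt0 i im; rewrite leq_eqVlt => /predU1P[i1|//].
  by case/existsP: no; exists (Ordinal im); rewrite -i1.
2: by left; apply: twos_expansion fB n_odd f_ge2.
have pair i : i < n -> #|fiber f i| + #|fiber f (i.+1 %% n)| <= 4.
  move=> im; apply: (fibers_le4 fB); last by rewrite /cyc eqxx.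
  case: (ltngtP i.+1 n) => [i1|i1|i1]; [by rewrite modn_small ?neq_ltn ?ltnSn|by lia|].
  by rewrite i1 modnn; lia.
have mod_lt i : i %% n < n by rewrite ltn_mod; lia.
have [y yn [fy fy1]] : exists2 y, y < n & #|fiber f y| = 1 /\ #|fiber f (y.+1 %% n)| <= 2.
  have [/existsP[y /andP[/eqP fy fy1]]|no] :=
    boolP [exists y : 'I_n, (#|fiber f y| == 1) && (#|fiber f (y.+1 %% n)| <= 2)].
    by exists y.
  have three i : i < n -> #|fiber f i| = 1 -> #|fiber f (i.+1 %% n)| = 3.
    move=> im fi; have := pair i im; rewrite fi.
    have := existsPn no (Ordinal im); rewrite fi /= -ltnNge; lia.
  (* A class of size 3 leaves room for one vertex in the next class, so singletons would recur at
     every second class. *)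
  have ones k : #|fiber f ((z + 2 * k) %% n)| = 1.
    elim: k => [|k IHk]; first by rewrite muln0 addn0 modn_small.
    have := three _ (mod_lt _) IHk; have := pair _ (mod_lt (z + 2 * k).+1).
    have := f_gt0 _ (mod_lt (z + 2 * k).+2).
    have E a : (a %% n).+1 %% n = a.+1 %% n by rewrite -addn1 modnDml addn1.
    by rewrite !E (_ : z + 2 * k.+1 = (z + 2 * k).+2); lia.
  (* As [n] is odd, [2 * n./2] steps lead to the class just before [z], which would force [z] to
     have size 3. *)
  have := three _ (mod_lt _) (ones n./2).
  rewrite -addn1 modnDml addn1 (_ : (z + 2 * n./2).+1 = z + n); last by lia.
  by rewrite modnDr modn_small // fz.
pose s := n.-1 - y; pose g := rotate s f; have gB : blowup g by apply: rotate_blowup.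
have g_gt0 i : i < n -> 0 < #|fiber g i|.
  move=> im; have -> : i = ((i + y.+1) %% n + s) %% n.
    rewrite modnDml (_ : i + y.+1 + s = i + n); last by rewrite /s; lia.
    by rewrite modnDr modn_small.
  by rewrite rotate_fiber // f_gt0.
have g_last : #|fiber g n.-1| = 1.
  have -> : n.-1 = (y + s) %% n by rewrite (_ : y + s = n.-1) ?modn_small //; rewrite /s; lia.
  by rewrite rotate_fiber.
have y1s : (y.+1 %% n + s) %% n = 0.
  by rewrite modnDml (_ : y.+1 + s = n) ?modnn //; rewrite /s; lia.
have g0 : #|fiber g 0| <= 2 by rewrite -[X in fiber g X]y1s rotate_fiber.
have [/existsP[j /and3P[j_even jn j3]]|no] :=
  boolP [exists j : 'I_n, [&& ~~ odd j, j.+1 < n & #|fiber g j| + #|fiber g j.+1| <= 3]].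
  by right; apply: odd_colorable gB n_odd g_gt0 g_last j_even jn j3.
left; apply: tight_expansion gB n_odd g_gt0 g_last g0 _ => j j_even jn.
have := existsPn no (Ordinal (ltnW jn)); rewrite /= j_even jn /=; lia.
Qed.
End Classes.

(** * Independence number two *)

(** Induction on [A]. If a proper nonempty [S] has exactly as many admissible values as elements,
    [S] and its complement are matched separately. Otherwise every such [S] has a spare value, and
    one element may take any value of its list. *)
Theorem hall (T U : finType) (u0 : U) (A : {set T}) (L : T -> {set U}) :
  (forall S : {set T}, S \subset A -> #|S| <= #|\bigcup_(x in S) L x|) ->
  exists2 f : T -> U, {in A &, injective f} & {in A, forall x, f x \in L x}.
Proof.
have [n] := ubnP #|A|; elim: n A L => // n IHn A L /ltnSE An hallA.
pose N (S : {set T}) := \bigcup_(x in S) L x.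
have [/set0Pn[a aA]|/negPn/eqP ->] := boolP (A != set0); last first.
  by exists (fun=> u0) => [x y|x]; rewrite inE.
have combine (S : {set T}) (V : {set U}) (f1 f2 : T -> U) : S \subset A ->
    {in S &, injective f1} -> {in S, forall x, f1 x \in L x :&: V} ->
    {in A :\: S &, injective f2} -> {in A :\: S, forall x, f2 x \in L x :\: V} ->
    exists2 f : T -> U, {in A &, injective f} & {in A, forall x, f x \in L x}.
  move=> SA f1_inj f1L f2_inj f2L; exists (fun x => if x \in S then f1 x else f2 x).
    move=> x y xA yA; case: ifPn => xS; case: ifPn => yS e.
    - exact: f1_inj.
    - have := f1L x xS; have := f2L y; rewrite in_setD yS yA => /(_ isT).
      by rewrite e !inE => /andP[/negPf -> _]; rewrite andbF.
    - have := f1L y yS; have := f2L x; rewrite in_setD xS xA => /(_ isT).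
      by rewrite e !inE => /andP[/negPf -> _]; rewrite andbF.
    - by apply: f2_inj; rewrite // inE ?xS ?yS.
  move=> x xA /=; case: ifPn => xS; first by have := f1L x xS; rewrite inE => /andP[].
  by have := f2L x; rewrite !inE xS xA => /(_ isT)/andP[].
have [/existsP[S /and4P[SA S0 SnA /eqP SN]]|no] :=
  boolP [exists S : {set T}, [&& S \subset A, S != set0, S != A & #|N S| == #|S|]].
  have SltA : #|S| < #|A| by apply: proper_card; rewrite properEneq SnA.
  have [|S' S'S|f1 f1_inj f1L] := IHn S L; first by lia.
    by apply: hallA; apply: subset_trans SA.
  have [||f2 f2_inj f2L] := IHn (A :\: S) (fun x => L x :\: N S).
  - have S_gt0 : 0 < #|S| by rewrite card_gt0.
    by rewrite cardsDS //; lia.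
  - move=> S' S'A; have := hallA (S :|: S').
    rewrite subUset SA (subset_trans S'A (subsetDl _ _)) => /(_ isT).
    rewrite cardsU (_ : S :&: S' = set0) ?cards0 ?subn0; last first.
      apply/setP => x; rewrite !inE; apply/negP => /andP[xS /(subsetP S'A)].
      by rewrite inE xS.
    rewrite bigcup_setU -/(N S).
    have -> : \bigcup_(x in S') (L x :\: N S) = \bigcup_(x in S') L x :\: N S.
      apply/setP => u; rewrite inE; apply/bigcupP/andP => [[x xS' /setDP[ux uN]]|[uN /bigcupP[x xS' ux]]].
        by split=> //; apply/bigcupP; exists x.
      by exists x => //; rewrite inE uN.
    by rewrite cardsU -/(N S) cardsD setIC; have := subset_leq_card (subsetIl (N S) (N S'));
      rewrite /N in SN *; lia.
  apply: (combine S (N S) f1 f2) => // x xS; rewrite inE f1L //.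
  by apply/bigcupP; exists x => //; apply: f1L.
have strict (S : {set T}) : S \subset A -> S != set0 -> S != A -> #|S| < #|N S|.
  move=> SA S0 SnA; rewrite ltn_neqAle hallA // andbT eq_sym.
  by apply: contra no => SN; apply/existsP; exists S; rewrite SA S0 SnA SN.
have /card_gt0P[u ua] : 0 < #|L a|.
  by have := hallA [set a]; rewrite sub1set aA big_set1 cards1; apply.
have [||f2 f2_inj f2L] := IHn (A :\: [set a]) (fun x => L x :\: [set u]).
- have A_gt0 : 0 < #|A| by apply/card_gt0P; exists a.
  by rewrite cardsDS ?sub1set // cards1; lia.
- move=> S SA; have [->|S0] := eqVneq S set0; first by rewrite cards0.
  have aS : a \notin S by apply/negP => /(subsetP SA); rewrite !inE eqxx.
  have := strict S (subset_trans SA (subsetDl _ _)) S0; rewrite /N.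
  have -> : \bigcup_(x in S) (L x :\: [set u]) = \bigcup_(x in S) L x :\: [set u].
    apply/setP => v; rewrite inE; apply/bigcupP/andP => [[x xS /setDP[vx vN]]|[vN /bigcupP[x xS vx]]].
      by split=> //; apply/bigcupP; exists x.
    by exists x => //; rewrite inE vN.
  move=> /(_ _)/leq_trans SN; rewrite -ltnS; apply: SN; first by apply: contraNneq aS => ->.
  rewrite (cardsD1 u (\bigcup_(x in S) L x)); case: (u \in _) => //=; lia.
apply: (combine [set a] [set u] (fun=> u) f2); rewrite ?sub1set //.
  by move=> x y /set1P -> /set1P ->.
by move=> x /set1P ->; rewrite !inE ua eqxx.
Qed.

(* Color one clique injectively; the vertices of the other one are then matched
   to the remaining admissible colors, and Hall's condition says that a subset S
   and its common neighbors form a clique. *)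
Lemma cobipartite_colorable (G : sgraph) (c : pred G) :
  ~ contains G (join (spindle 1) (complete 1)) ->
  (forall x y, c x = c y -> adjeq x y) -> colorable G 4.
Proof.
move=> noK5 cl; pose X := [set x | c x]; pose Y := [set x | ~~ c x].
have Y4 : #|Y| <= 4.
  by apply: clique_le4 => // x y; rewrite !inE => /negbTE xc /negbTE yc; rewrite cl ?xc ?yc.
pose g y : 'I_4 := inord (index y (enum Y)).
have g_inj : {in Y &, injective g}.
  move=> x y xY yY /(congr1 val); rewrite /= !inordK; last 2 first.
  - by apply: leq_trans Y4; rewrite cardE index_mem mem_enum.
  - by apply: leq_trans Y4; rewrite cardE index_mem mem_enum.
  by move=> e; rewrite -(nth_index x (s := enum Y) (x := x)) ?e ?nth_index ?mem_enum.
pose L x := [set k | [forall y in Y, adjeq x y ==> (g y != k)]].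
have [|f f_inj fL] := @hall _ _ ord0 X L.
  move=> S SX; have [->|[x0 x0S]] := set_0Vmem S; first by rewrite cards0.
  pose Z := [set y in Y | [forall x in S, adjeq x y]].
  (* A color refused to all of [S] is worn by one vertex of [Y], as [g] is injective, and this
     vertex is adjacent to all of [S]. Since [S] and [Z] form a clique, at most [4 - #|S|] colors
     are refused. *)
  have compl : ~: (\bigcup_(x in S) L x) \subset g @: Z.
    apply/subsetP => k; rewrite inE => /bigcupP kN.
    have blocked x : x \in S -> exists2 y, y \in Y & adjeq x y && (g y == k).
      move=> xS; have [/exists_inP[y yY gy]|no] := boolP [exists y in Y, adjeq x y && (g y == k)].
        by exists y.
      case: kN; exists x => //; rewrite inE; apply/forall_inP => y yY.
      by apply/implyP => xy; apply: contra no => gy; apply/exists_inP; exists y; rewrite ?xy.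
    have [y yY /andP[_ /eqP gy]] := blocked x0 x0S; apply/imsetP; exists y => //.
    rewrite inE yY; apply/forall_inP => x /blocked[z zY /andP[xz /eqP gz]].
    by rewrite -(g_inj z y) // gz gy.
  have := leq_trans (subset_leq_card compl) (leq_imset_card g Z).
  have := cardsC (\bigcup_(x in S) L x); rewrite card_ord.
  suff : #|S| + #|Z| <= 4 by lia.
  have -> : #|S| + #|Z| = #|S :|: Z|.
    rewrite -cardsUI (_ : S :&: Z = set0) ?cards0 ?addn0 //.
    apply/setP => x; rewrite !inE; apply/negP => /and3P[/(subsetP SX)].
    by rewrite inE => ->.
  apply: clique_le4 => // x y; rewrite !in_setU.
  have SZ a b : a \in S -> b \in Z -> adjeq a b by move=> aS; rewrite inE => /andP[_ /forall_inP];
    apply.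
  move=> /orP[xS|xZ] /orP[yS|yZ].
  - by have := subsetP SX x xS; have := subsetP SX y yS; rewrite !inE => yc xc; rewrite cl ?xc ?yc.
  - exact: SZ.
  - by rewrite adjeqC SZ.
  - by move: xZ yZ; rewrite !inE => /andP[/negbTE xc _] /andP[/negbTE yc _]; rewrite cl ?xc ?yc.
have fg x y : c x -> ~~ c y -> adj x y -> f x != g y.
  move=> xc yc xy; have := fL x; rewrite !inE xc => /(_ isT)/forall_inP/(_ y).
  by rewrite inE yc adj_adjeq //= eq_sym => /(_ isT).
exists (fun x => if c x then f x else g x) => x y xy.
have nxy : x != y by apply: contraTneq xy => ->; rewrite adj_irrefl.
case: ifPn => xc; case: ifPn => yc; last 1 first.
- by apply: contra_neq nxy; apply: g_inj; rewrite inE.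
- by apply: contra_neq nxy; apply: f_inj; rewrite inE.
- exact: fg.
- by rewrite eq_sym fg // adj_sym.
Qed.

(** * Odd closed walks, bipartiteness and odd holes *)

Section OddWalks.
Variables (T : finType) (h : rel T).
Hypotheses (h_sym : symmetric h) (h_irr : irreflexive h).

Definition closed_walk n (w : nat -> T) := (forall i, i < n -> h (w i) (w i.+1)) /\ w n = w 0.

(** The bipartite double cover: a path between the two lifts of a vertex projects to an odd closed
    walk. *)
Let cover : rel (T * bool) := fun a b => h a.1 b.1 && (a.2 != b.2).

Let cover_sym : connect_sym cover.
Proof. by apply: sym_connect_sym => a b; rewrite /cover h_sym eq_sym. Qed.

Lemma odd_walk_or_bipartite :
  (exists n w, odd n /\ closed_walk n w) \/ (exists c : pred T, forall x y, h x y -> c x != c y).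
Proof.
have [/existsP[x /connectP[p xp p_last]]|no] := boolP [exists x, connect cover (x, false) (x,
  true)].
  left; pose v := nth (x, false) ((x, false) :: p); exists (size p), (fun i => (v i).1).
  have step i : i < size p -> cover (v i) (v i.+1) by move=> ip; apply: (pathP (x, false) xp).
  have par i : i <= size p -> (v i).2 = odd i.
    elim: i => // i IHi ip; have /andP[_] := step i ip; rewrite (IHi (ltnW ip)) /=.
    by case: (odd i); case: (v i.+1).2.
  have v_last : v (size p) = (x, true) by rewrite p_last (last_nth (x, false)).
  split; first by rewrite -par // v_last.
  by split=> [i /step/andP[]//|]; rewrite v_last.
right; have h_csym : connect_sym h by apply: sym_connect_sym.
have lift r x s : connect h r x -> exists t, connect cover (r, s) (x, t).
  case/connectP=> p; elim: p r s => [|y p IHp] r s /= => [_ ->|/andP[ry yp] x_last].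
    by exists s; apply: connect0.
  have [t yt] := IHp y (~~ s) yp x_last; exists t.
  by apply: connect_trans yt; apply: connect1; rewrite /cover /= ry; case: s.
have {}no x : ~~ connect cover (x, false) (x, true) by have := existsPn no x.
(* Without odd closed walks the two lifts of [x] are disconnected in the cover, and exactly one of
   them is reached from the lift of the root; which one is the color. *)
exists (fun x => connect cover (root h x, false) (x, false)) => x y xy.
have rxy : root h x = root h y by apply/rootP => //; apply: connect1.
have rx : connect h (root h x) x by rewrite h_csym connect_root.
have step b : connect cover (x, b) (y, ~~ b).
  by apply: connect1; rewrite /cover /= xy; case: b.
rewrite -rxy; case: (boolP (connect _ _ (x, false))) => [xf|xf].
  apply/negP => /eqP/esym yf; case/negP: (no y).
  by apply: (connect_trans (y := (root h x, false)));
    [rewrite cover_sym | apply: connect_trans (step false)].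
have [[] xt] := lift _ _ false rx; last by rewrite xt in xf.
by rewrite eq_sym eqbF_neg negbK; apply: connect_trans (step true).
Qed.

(** A repeated vertex splits the walk into closed walks with lengths adding up to [n], a chord into
    two with sum [n + 2]. One of the two lengths is odd, and it is below [n]; a walk with neither
    defect is an induced cycle. *)
Lemma odd_hole n w : odd n -> closed_walk n w ->
  exists m v, [/\ odd m, 2 < m, {in gtn m &, injective v} &
    forall i j, i < m -> j < m -> i != j -> h (v i) (v j) = cyc m i j].
Proof.
have [k] := ubnP n; elim: k n w => // k IHk n w /ltnSE nk n_odd [w_adj w_last].
have n3 : 2 < n.
  case: n n_odd {nk} w_adj w_last => [|[|[|n]]] // _ w_adj w_last.
  by have := w_adj 0 isT; rewrite w_last h_irr.
pose bad (i j : 'I_n) := (i < j) && ((w i == w j) || h (w i) (w j) && ~~ cyc n i j).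
have [/existsP[i /existsP[j]]|no] := boolP [exists i, exists j, bad i j]; last first.
  have good i j : i < j -> j < n -> w i != w j /\ (h (w i) (w j) -> cyc n i j).
    move=> ij jn; have in_ := ltn_trans ij jn.
    have /existsPn/(_ (Ordinal jn)) := existsPn no (Ordinal in_).
    by rewrite /bad /= ij /= negb_or negb_and negbK => /andP[-> /orP[/negbTE ->|->]].
  have cyc_adj i j : i < n -> j < n -> cyc n i j -> h (w i) (w j).
    move=> im jm /(cyc_cases n3 im jm)[-> | -> |[-> ->]|[-> ->]].
    - exact: w_adj.
    - by rewrite h_sym; apply: w_adj.
    - by rewrite -w_last -{2}(ltn_predK n3) w_adj // (ltn_predK n3).
    - by rewrite h_sym -w_last -{2}(ltn_predK n3) w_adj // (ltn_predK n3).
  exists n, w; split=> //.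
    by apply: gtn_inj => i j im ji; rewrite eq_sym; case: (good j i ji im).
  move=> i j im jm; rewrite neq_ltn => /orP[ij|ji]; apply/idP/idP; try exact: cyc_adj.
    by case: (good i j ij jm).
  by rewrite h_sym cyc_sym; case: (good j i ji im).
case: i j => [i im] [j jm]; rewrite /bad /= => /andP[ij].
have shift d l : (forall a, a < l -> d + a.+1 <= n) -> forall a, a < l ->
  h (w (d + a)) (w (d + a.+1)).
  by move=> dl a al; rewrite addnS; apply: w_adj; rewrite -addnS dl.
have short l v : odd l -> l < n -> closed_walk l v -> _ :=
  fun lo ln => IHk l v (leq_trans ln nk) lo.
pose d := j - i.
case/orP=> [/eqP wij|/andP[hij ncyc]].
  have [d_odd|d_even] := boolP (odd d).
    apply: (short d (fun a => w (i + a))) => //; first by rewrite /d; lia.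
    split; last by rewrite /d subnKC ?(ltnW ij) // addn0.
    by apply: shift => a; rewrite /d; lia.
  apply: (short (n - d) (fun a => if a <= i then w a else w (a + d)));
    try by rewrite /d in d_even *; lia.
  split=> [a al|]; last first.
    rewrite leqNgt (_ : i < n - d) /=; last by rewrite /d; lia.
    by rewrite subnK ?w_last // /d; lia.
  case: (ltngtP a i) => [ai|ai|->]; first exact: w_adj (ltn_trans ai im).
    by rewrite addSn; apply: w_adj; rewrite /d in al *; lia.
  by rewrite wij addSn (_ : i + d = j) ?w_adj // /d subnKC // ltnW.
have d2 : 2 <= d <= n - 2.
  move: ncyc; rewrite /cyc (modn_small (leq_ltn_trans ij jm)) negb_or => /andP[ij1].
  have [jn|jn] := ltnP j.+1 n; first by rewrite /d; lia.
  have jnE : j.+1 = n by lia.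
  by rewrite jnE modnn /d; lia.
have [d_odd|d_even] := boolP (odd d).
  apply: (short (n - d).+1 (fun a => if a <= i then w a else w (a + d.-1))); try by lia.
  split=> [a al|]; last first.
    rewrite leqNgt (_ : i < (n - d).+1) /=; last by rewrite /d; lia.
    by rewrite (_ : (n - d).+1 + d.-1 = n) ?w_last //; lia.
  case: (ltngtP a i) => [ai|ai|->]; first exact: w_adj (ltn_trans ai im).
    by rewrite addSn; apply: w_adj; lia.
  by rewrite (_ : i.+1 + d.-1 = j) //; rewrite /d in d2 *; lia.
apply: (short d.+1 (fun a => if a <= d then w (i + a) else w i)); try by rewrite /=; lia.
split=> [a al|]; last by rewrite ltnn addn0.
case: (ltngtP a d) => [ad|ad|->].
- by rewrite addnS; apply: w_adj; rewrite /d in ad; lia.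
- by lia.
- by rewrite /d subnKC ?(ltnW ij) // h_sym.
Qed.
End OddWalks.

(** The expansion [C_5[2,2,2,2,1]] on 0, ..., 8, where [i./2] is the class of [i]. *)
Definition E22221_pat : rel nat := fun i j => (i./2 == j./2) || cyc 5 i./2 j./2.
Definition empty_pat : rel nat := fun _ _ => false.

Lemma E22221_pat_sym : symmetric E22221_pat.
Proof. by move=> i j; rewrite /E22221_pat eq_sym cyc_sym. Qed.

Lemma C7K1_pat_sym : symmetric C7K1_pat.
Proof. by move=> i j; rewrite /C7K1_pat orbCA cyc_sym. Qed.

Lemma contains_E22221 (G : sgraph) (g : nat -> G) : {in gtn 9 &, injective g} ->
  (forall i j, i < 9 -> j < 9 -> i != j -> E22221_pat i j -> adj (g i) (g j)) ->
  expansion_case G.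
Proof.
move=> g_inj gP; exists 2, (twos_then_one 4); split=> //; first by right; exists 4.
pose rk (x : clique_expansion (twos_then_one 4)) : nat := 2 * tag x + tagged x.
have le1 (x : clique_expansion (twos_then_one 4)) : tagged x <= 1 /\ rk x < 9.
  by rewrite /rk; case: x => [[[|[|[|[|[|//]]]]] i]] [r] /=; lia.
have half_rk x : (rk x)./2 = tag x by have [] := le1 x; rewrite /rk; lia.
apply: (@contains_rank G (clique_expansion (twos_then_one 4)) 9 E22221_pat rk) g_inj gP.
- move=> x y xy; have := half_rk x; rewrite xy half_rk => /val_inj.
  move: xy; rewrite /rk; case: x y => [i r] [j s] /= e ij; subst j.
  by congr existT; apply: val_inj => /=; lia.
- by move=> x; case: (le1 x).
- move=> x y /= /andP[_]; rewrite /E22221_pat !half_rk /cyc.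
  by case/orP=> /orP[] /eqP ->; rewrite eqxx ?orbT.
Qed.

(** Verifies a given embedding [p] instead of searching for one. *)
Definition fits (P : rel nat) n M (p : seq nat) :=
  [&& uniq p, size p == n, all (fun v => v < size M) p &
   all (fun i => all (fun j => P i j ==> entry M (nth 0 p i) (nth 0 p j)) (iota 0 i)) (iota 0 n)].

Lemma fitsP (G : sgraph) (x0 : G) s P n p : uniq s -> symmetric P ->
  fits P n (rows (pattern x0 s) (size s)) p ->
  exists2 g : nat -> G, {in gtn n &, injective g} &
    forall i j, i < n -> j < n -> i != j -> P i j -> adj (g i) (g j).
Proof.
move=> s_uniq P_sym /and4P[p_uniq /eqP p_size /all_nthP p_lt /allP pP].
rewrite size_pattern in p_lt.
have lt i : i < n -> nth 0 p i < size s by rewrite -p_size; apply: p_lt.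
have H i j : i < n -> j < i -> P i j -> adj (nth x0 s (nth 0 p i)) (nth x0 s (nth 0 p j)).
  move=> im ji; have jm := ltn_trans ji im.
  have /pP/allP/(_ j) : i \in iota 0 n by rewrite mem_iota.
  rewrite mem_iota => /(_ ji)/implyP Pij /Pij.
  rewrite (entry_rows (@pattern_sym G x0 s)) ?lt // nth_uniq ?p_size //.
  by rewrite neq_ltn ji orbT.
exists (fun i => nth x0 s (nth 0 p i)).
  apply: gtn_inj => i j im ji; have jm := ltn_trans ji im.
  by rewrite !nth_uniq ?lt ?p_size // neq_ltn ji orbT.
move=> i j im jm; rewrite neq_ltn => /orP[ij|ji]; last exact: H.
by rewrite P_sym adj_sym; apply: H.
Qed.

(** * Graphs containing an induced complement of the seven-cycle *)

Definition C7c_rows := rows (fun i j => ~~ cyc 7 i j) 7.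
Definition anti3_rows := rows empty_pat 3.

Definition anti3_or_C5 M := has_ind anti3_rows M || has_ind C5_rows M.

(** In the complement, the new vertex has on the 7-cycle no neighbor, one neighbor, or two at
    distance two: distance one gives a triangle and distance three an induced pentagon. *)
Definition heptagon_types := [seq t <- bits 7 | ~~ anti3_or_C5 (rcons C7c_rows t)].

Lemma heptagon_check1 :
  four_col C7c_rows && all (fun t => four_col (rcons C7c_rows t) ||
    fits C7K1_pat 8 (rcons C7c_rows t) (iota 0 8)) heptagon_types.
Proof. by vm_compute. Qed.

(* Embeddings found by computer. *)
Definition K5_maps := [:: [:: 0; 2; 4; 7; 8]; [:: 1; 3; 5; 7; 8]; [:: 1; 4; 6; 7; 8]].
Definition E22221_maps :=
  [:: [:: 2; 7; 6; 4; 8; 1; 5; 3; 0]; [:: 7; 3; 0; 5; 2; 8; 6; 4; 1]; [:: 0; 2; 7; 5; 1; 3; 6; 8;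
    4];
      [:: 4; 7; 1; 6; 8; 3; 0; 5; 2]; [:: 8; 1; 3; 5; 0; 7; 4; 2; 6]; [:: 5; 0; 2; 8; 6; 4; 1; 7;
        3];
      [:: 6; 8; 2; 4; 7; 0; 3; 5; 1]; [:: 8; 4; 2; 0; 7; 5; 1; 3; 6]; [:: 4; 2; 8; 0; 5; 7; 3; 1;
        6]].

(** The type of a vertex adjacent to the whole heptagon comes last in the order, so if one of the
    two new vertices has it, then vertex 8 does. *)
Definition heptagon_concl M :=
  [|| fits C7K1_pat 8 M [:: 0; 1; 2; 3; 4; 5; 6; 8], has (fits all_pat 5 M) K5_maps,
      has (fits E22221_pat 9 M) E22221_maps | anti3_or_C5 M].

(** Any two vertices outside the heptagon already force a conclusion, so graphs with more vertices
    need no further check. *)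
Lemma heptagon_check2 : all heptagon_concl (extensions C7c_rows 2 heptagon_types).
Proof. by vm_compute. Qed.

Section IndependenceTwo.
Variable G : sgraph.
Local Notation e := (@adjeq G).
Hypothesis noK5 : ~ contains G (join (spindle 1) (complete 1)).
Hypothesis noC5 : ~ contains_induced G (cycle_graph 5).
Hypothesis alpha2 : forall x y z : G, ~~ e x y -> ~~ e x z -> ~~ e y z -> False.

Lemma no_C5_pat (g : nat -> G) : {in gtn 5 &, injective g} ->
  (forall i j, i < 5 -> j < 5 -> i != j -> adj (g i) (g j) = cyc 5 i j) -> False.
Proof.
move=> g_inj gP; apply: noC5.
apply: (@contains_induced_rank G (cycle_graph 5) 5 (cyc 5) val) g_inj gP.
- exact: val_inj.
- by move=> x; apply: ltn_ord.
- by move=> x y xy; rewrite adj_cycle xy.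
Qed.

Lemma anti3_or_C5F (x0 : G) s : uniq s -> ~~ anti3_or_C5 (rows (pattern x0 s) (size s)).
Proof.
move=> s_uniq; apply/negP => /orP[] /(has_indP s_uniq)[] //.
  move=> g g_inj gP.
  have h i j : i < 3 -> j < 3 -> i != j -> ~~ e (g i) (g j).
    move=> i3 j3 ij; rewrite /adjeq gP // orbF; apply: contra ij => /eqP /g_inj h.
    by apply/eqP; apply: h.
  exact: (alpha2 (h 0 1 isT isT isT) (h 0 2 isT isT isT) (h 1 2 isT isT isT)).
- exact: cyc_sym.
- exact: no_C5_pat.
Qed.

Section Heptagon.
Variable v : nat -> G.
Hypotheses (v_inj : {in gtn 7 &, injective v})
  (v_adj : forall i j, i < 7 -> j < 7 -> i != j -> adj (v i) (v j) = ~~ cyc 7 i j).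

Let s0 := [seq v i | i <- iota 0 7].

Let s0_uniq : uniq s0.
Proof.
rewrite map_inj_in_uniq ?iota_uniq // => i j.
by rewrite !mem_iota => i7 j7; apply: v_inj.
Qed.

Let s0_rows : rows (pattern (v 0) s0) (size s0) = C7c_rows.
Proof.
apply: eq_rows => i j ji i7; have j7 := ltn_trans ji i7; rewrite /pattern.
rewrite !(nth_map 0) ?size_iota // !nth_iota // v_adj //.
by rewrite neq_ltn ji orbT.
Qed.

Let s0_type x : x \notin s0 -> type_on s0 x \in heptagon_types.
Proof.
move=> xs; rewrite mem_filter mem_bits size_map size_rev andbT.
have := @anti3_or_C5F (v 0) (s0 ++ [:: x]); rewrite rows_pattern_cat s0_rows; apply.
by rewrite cat_uniq s0_uniq /= orbF xs.
Qed.

Lemma heptagon_case : [\/ contains G (join (complement (cycle_graph 7)) (complete 1)),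
  expansion_case G | colorable G 4].
Proof.
set r := [seq x <- enum G | x \notin s0].
have r_mem x : (x \in r) = (x \notin s0) by rewrite mem_filter mem_enum andbT.
have r_uniq : uniq r by rewrite filter_uniq ?enum_uniq.
have [col0 /allP check1] := andP heptagon_check1.
have s_all x : x \in s0 ++ r by rewrite mem_cat r_mem orbN.
case: r => [|x [|y r']] in r_mem r_uniq s_all *.
- constructor 3; rewrite cats0 in s_all; apply: (four_colP (x0 := v 0) s_all).
  by rewrite s0_rows.
- have xs : x \notin s0 by rewrite -r_mem inE.
  have s_uniq : uniq (s0 ++ [:: x]) by rewrite cat_uniq s0_uniq /= orbF xs.
  have sx_rows := rows_pattern_cat (v 0) s0 [:: x]; rewrite s0_rows in sx_rows.
  have [col|/(_ =P true) fit] := orP (check1 _ (s0_type xs)).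
    by constructor 3; apply: (four_colP (x0 := v 0) s_all); rewrite sx_rows.
  have [|g g_inj gP] := fitsP (x0 := v 0) (p := iota 0 8) s_uniq C7K1_pat_sym (n := 8).
    by rewrite sx_rows; apply/eqP.
  by constructor 1; apply: contains_C7K1 g_inj gP.
have [q q_perm q_sorted] := sort_types s0 heptagon_types [:: x; y].
have q_size : size q = 2 by rewrite (perm_size q_perm).
have q_new z : z \in q -> z \notin s0.
  by rewrite -r_mem (perm_mem q_perm) !inE => /orP[] ->; rewrite ?orbT.
have q_uniq : uniq q.
  by rewrite (perm_uniq q_perm); move: r_uniq => /=; rewrite !inE negb_or -andbA => /and3P[->].
have s_uniq : uniq (s0 ++ q).
  by rewrite cat_uniq s0_uniq q_uniq andbT; apply/hasPn.
have q_types : all (fun z => type_on s0 z \in heptagon_types) q.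
  by apply/allP => z /q_new/s0_type.
have := mem_extensions (v 0) q_types q_sorted; rewrite s0_rows q_size.
move/(allP heptagon_check2); case/or4P.
- case/(fitsP s_uniq C7K1_pat_sym) => g g_inj gP.
  by constructor 1; apply: contains_C7K1 g_inj gP.
- case/hasP=> p _ /(fitsP s_uniq all_pat_sym)[g g_inj gP].
  by case: noK5; apply: contains_K5 g_inj _ => i j ? ? ?; apply: gP.
- case/hasP=> p _ /(fitsP s_uniq E22221_pat_sym)[g g_inj gP].
  by constructor 2; apply: contains_E22221 g_inj gP.
- by move=> bad; have := anti3_or_C5F (v 0) s_uniq; rewrite bad.
Qed.
End Heptagon.

Lemma independence_two_case :
  [\/ contains G (join (complement (cycle_graph 7)) (complete 1)),
      expansion_case G | colorable G 4].
Proof.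
pose h x y := ~~ e x y.
have h_sym : symmetric h by move=> x y; rewrite /h adjeqC.
have h_irr : irreflexive h by move=> x; rewrite /h adjeqxx.
have [[n [w [n_odd w_walk]]]|[c cP]] := odd_walk_or_bipartite h_sym; last first.
  constructor 3; apply: (cobipartite_colorable (c := c) noK5) => x y xy.
  by apply/negPn/negP => /cP; rewrite xy eqxx.
have {n w n_odd w_walk}[m [v [m_odd m3 v_inj vP]]] := odd_hole h_sym h_irr n_odd w_walk.
have v_adj i j : i < m -> j < m -> i != j -> adj (v i) (v j) = ~~ cyc m i j.
  move=> im jm ij; rewrite -vP // /h negbK adjE; case: eqP => // /v_inj vij.
  by case/eqP: ij; apply: vij.
have [m11|m11] := ltnP 10 m.
  (* 0, 2, 4, 6, 8 are pairwise nonconsecutive on the hole. On a 9-cycle this would fail for 8 and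
     0. *)
  case: noK5; apply: (@contains_K5 _ (fun i => v (2 * i))) => [i j i5 j5 /v_inj vij|i j i5 j5 ij].
    have lt k : k < 5 -> 2 * k < m by lia.
    have : 2 * i = 2 * j by apply: vij; apply: lt.
    by lia.
  rewrite v_adj; try lia.
  by rewrite /cyc !modn_small; lia.
have : [\/ m = 3, m = 5, m = 7 | m = 9].
  by case: m m_odd m3 m11 {v_inj vP v_adj} => [|[|[|[|[|[|[|[|[|[|[|]]]]]]]]]]] //;
    [constructor 1|constructor 2|constructor 3|constructor 4].
case=> mE; subst m.
- by case: (@alpha2 (v 0) (v 1) (v 2)); rewrite -/(h _ _) vP.
(* Doubling modulo 5 is an isomorphism from the 5-cycle to its complement. *)
- case: (@no_C5_pat (fun i => v ((2 * i) %% 5))) => [i j i5 j5 /v_inj vij|i j i5 j5 ij].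
    have : (2 * i) %% 5 = (2 * j) %% 5 by apply: vij; apply: ltn_pmod.
    by have {}i5 : i < 5 := i5; have {}j5 : j < 5 := j5; lia.
  rewrite v_adj ?ltn_pmod //; last by lia.
  by case: i i5 ij => [|[|[|[|[|//]]]]] _; case: j j5 => [|[|[|[|[|//]]]]].
- exact: heptagon_case v_inj v_adj.
(* The classes are {0,2}, {4,6}, {8,1}, {3,5}, {7}: within a class and between cyclically
   consecutive classes, no two indices are consecutive on the 9-cycle. *)
- constructor 2; pose p := [:: 0; 2; 4; 6; 8; 1; 3; 5; 7].
  apply: (@contains_E22221 _ (fun i => v (nth 0 p i))) => [i j i9 j9 /v_inj vij|i j i9 j9 ij].
    have lt9 k : k < 9 -> nth 0 p k < 9 by case: k => [|[|[|[|[|[|[|[|[|]]]]]]]]].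
    by apply/eqP; rewrite -(@nth_uniq _ 0 p) //; apply/eqP/vij; apply: lt9.
  have : all (fun i => all (fun j => (i != j) && E22221_pat i j ==>
      (nth 0 p i != nth 0 p j) && ~~ cyc 9 (nth 0 p i) (nth 0 p j)) (iota 0 9)) (iota 0 9) by [].
  move/allP/(_ i); rewrite mem_iota => /(_ i9)/allP/(_ j); rewrite mem_iota => /(_ j9).
  rewrite ij => /implyP Eij /Eij /andP[pij]; rewrite -v_adj //.
    by case: (i) i9 => [|[|[|[|[|[|[|[|[|]]]]]]]]].
  by case: (j) j9 => [|[|[|[|[|[|[|[|[|]]]]]]]]].
Qed.
End IndependenceTwo.

(** * Conclusion *)

(** Finiteness of the graphs makes the case distinctions of the final proof constructive. *)
Lemma contains_dec (G H : sgraph) : decidable (contains G H).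
Proof.
apply: (@decP _ [exists f : {ffun H -> G}, injectiveb f &&
  [forall x, forall y, adj x y ==> adj (f x) (f y)]]).
apply: (iffP existsP) => [[f /andP[/injectiveP f_inj /forallP fP]]|[f f_inj fP]].
  by exists f => // x y; move/forallP: (fP x) => /(_ y)/implyP.
exists [ffun x => f x]; apply/andP; split.
  by apply/injectiveP => x y; rewrite !ffunE => /f_inj.
by apply/forallP => x; apply/forallP => y; apply/implyP => /fP; rewrite !ffunE.
Qed.

Lemma contains_induced_dec (G H : sgraph) : decidable (contains_induced G H).
Proof.
apply: (@decP _ [exists f : {ffun H -> G}, injectiveb f &&
  [forall x, forall y, adj (f x) (f y) == adj x y]]).
apply: (iffP existsP) => [[f /andP[/injectiveP f_inj /forallP fP]]|[f f_inj fP]].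
  by exists f => // x y; move/forallP: (fP x) => /(_ y)/eqP.
exists [ffun x => f x]; apply/andP; split.
  by apply/injectiveP => x y; rewrite !ffunE => /f_inj.
by apply/forallP => x; apply/forallP => y; rewrite !ffunE fP.
Qed.

Lemma independence_three_case (G : sgraph) (a b c : G) : connected G ->
  ~ contains_induced G bull -> ~ contains_induced G claw ->
  ~ contains G (join (spindle 1) (complete 1)) ->
  ~~ adjeq a b -> ~~ adjeq a c -> ~~ adjeq b c ->
  expansion_case G \/ colorable G 4.
Proof.
move=> Gconn Gbull Gclaw noK5 ab ac bc.
have [n [f [n6 f_lt fP f_onto]]] := cycle_blowup Gconn Gbull Gclaw ab ac bc.
have n3 : 2 < n by lia.
have fB : blowup n f by [].
have [n_odd|n_even] := boolP (odd n); last first.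
  by right; apply: (parity_colorable n3 noK5 fB); left.
have [/existsP[x /eqP fx]|no] := boolP [exists x, f x == n.-1]; last first.
  by right; apply: (parity_colorable n3 noK5 fB); right; apply/existsPn.
apply: (odd_blowup n3 noK5 fB n_odd) => i im; apply/card_gt0P.
have [i1|i1] := ltnP i.+1 n; first by have [y yi] := f_onto i i1; exists y; rewrite inE yi.
by exists x; rewrite inE fx; lia.
Qed.

Theorem theorem1p6 (G : sgraph)
  (Gconn : connected G)
  (Gbull : ~ contains_induced G bull)
  (Gclaw : ~ contains_induced G claw) :
  contains G (join (complement (cycle_graph 7)) (complete 1))
  \/ contains G (join (cycle_graph 5) (complete 2))
  \/ (contains G (join (spindle 1) (complete 1))
      \/ contains G (join (spindle 2) (complete 1)))
  \/ (exists (i : nat) (k : seq nat),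
        [/\ 1 <= i,
            size k = 2 * i + 1,
            (exists a b : nat, ~~ odd a /\ k = twos_then_alternating a b)
            \/ (exists a : nat, k = twos_then_one a)
          & contains G (clique_expansion k)])
  \/ (contains_induced G (cycle_graph 5) /\ 8 < #|G|)
  \/ colorable G 4.
Proof.
have [K5|noK5] := contains_dec G (join (spindle 1) (complete 1)); first by tauto.
have [C5|noC5] := contains_induced_dec G (cycle_graph 5).
  have [G8|G8] := leqP #|G| 8; last by right; right; right; right; left.
  have [f f_inj f_adj] := C5.
  by case: (pentagon_small Gconn Gbull Gclaw f_inj f_adj G8); tauto.
rewrite -/(expansion_case G).
have [/existsP[a /existsP[b /existsP[c /and3P[ab ac bc]]]]|alpha2] :=
  boolP [exists a, exists b, exists c : G, [&& ~~ adjeq a b, ~~ adjeq a c & ~~ adjeq b c]].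
  by case: (independence_three_case Gconn Gbull Gclaw noK5 ab ac bc); tauto.
have [] // := @independence_two_case G noK5 noC5; try tauto.
move=> a b c ab ac bc; case/existsP: alpha2; exists a; apply/existsP; exists b.
by apply/existsP; exists c; rewrite ab ac.
Qed.
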